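(* Let $d\ge 3$ and let $B>2$. For positive integers $t$ put $\mu(t)=\gamma(1-\gamma)^{t-1}$, and put $t_n=[\lambda\log n-\lambda B\log\log n]$. Then $$\lim_{n\to\infty}\sup_{t\le t_n}\left|\frac{U(t,n)}{n\gamma\mu(t)}-1\right|=0\quad\text{a.s.},$$ $$\lim_{n\to\infty}\sup_{t\le t_n}\left|\frac{Q(t,n)}{n\gamma\mu(t)}-1\right|=0\quad\text{a.s.},$$ $$\lim_{n\to\infty}\sup_{t\le t_n}\left|\frac{V(t,n)}{n\mu(t)}-1\right|=0\quad\text{a.s.},$$ $$\lim_{n\to\infty}\sup_{t\le t_n}\left|\frac{R(t,n)}{n\mu(t)}-1\right|=0\quad\text{a.s.},$$ where in $\sup_{t\le t_n}$ the variable $t$ runs through positive integers.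
   Context: $\{\mathbf S_n\}_{n\ge 0}$ is the simple symmetric random walk on the $d$-dimensional integer lattice $\mathcal Z_d$: $\mathbf S_0=\mathbf 0$, $\mathbf S_n=\sum_{k=1}^n\mathbf X_k$ with $\mathbf X_k$ i.i.d., $\mathbf P(\mathbf X_1=\mathbf e_i)=\mathbf P(\mathbf X_1=-\mathbf e_i)=\frac1{2d}$, $i=1,\dots,d$, where $\mathbf e_1,\dots,\mathbf e_d$ are the orthogonal unit vectors of $\mathcal Z_d$. The local time is $\xi(\mathbf x,n)=\#\{k:0<k\le n,\ \mathbf S_k=\mathbf x\}$ for $\mathbf x\in\mathcal Z_d$, $n=1,2,\dots$, and $\xi(\mathbf x,\infty)=\#\{k\ge 1:\mathbf S_k=\mathbf x\}$ is the total local time. $\gamma=\gamma(\infty;d)>0$ is the probability that the walk never returns to its starting point, and $\lambda=\lambda_d=-1/\log(1-\gamma)$. $[\cdot]$ denotes the integer part. For positive integers $k,n$: $Q(k,n)=\#\{\mathbf x\in\mathcal Z_d:\ \xi(\mathbf x,n)=k\}$; $U(k,n)=\#\{j:0<j\le n,\ \xi(\mathbf S_j,\infty)=k,\ \mathbf S_j\ne\mathbf S_\ell\ (\ell=1,\dots,j-1)\}=\#\{\mathbf x\in\mathcal Z_d:\ 0<\xi(\mathbf x,n)\le\xi(\mathbf x,\infty)=k\}$; $R(k,n)=\sum_{j=k}^\infty Q(j,n)$; $V(k,n)=\sum_{j=k}^\infty U(j,n)$. *)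

(* Defs.v *)
From HB Require Import structures.
From mathcomp Require Import all_boot all_order all_algebra finmap.
From mathcomp Require Import all_classical all_reals all_analysis.

Set Implicit Arguments.
Unset Strict Implicit.
Unset Printing Implicit Defensive.

Import Order.TTheory GRing.Theory Num.Theory.
Import numFieldNormedType.Exports.

Local Open Scope classical_set_scope.
Local Open Scope ring_scope.

(* The lattice carries the discrete sigma-algebra, so a lattice-valued random
   variable is a map all of whose preimages are measurable. *)
Definition lattice_rv (disp : measure_display) (Omega : measurableType disp)
    (d : nat) (Y : Omega -> 'rV[int]_d) : Prop :=
  forall A : set 'rV[int]_d, measurable (Y @^-1` A).

Definition mutually_independent (R : realType) (disp : measure_display)
    (Omega : measurableType disp) (P : probability Omega R) (d : nat)
    (X : nat -> Omega -> 'rV[int]_d) : Prop :=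
  forall (J : {fset nat}) (A : nat -> set 'rV[int]_d),
    P (\bigcap_(k in [set` J]) (X k @^-1` A k)) =
    (\prod_(k <- J) P (X k @^-1` A k))%E.

(* [X k] is the (k+1)-st step of the walk; [delta_mx 0 i] is the i-th unit
   vector.  The prescribed probabilities sum to 1, so they determine the
   common law of the steps. *)
Definition simple_walk_steps (R : realType) (disp : measure_display)
    (Omega : measurableType disp) (P : probability Omega R) (d : nat)
    (X : nat -> Omega -> 'rV[int]_d) : Prop :=
  [/\ forall k, lattice_rv (X k),
      mutually_independent P X &
      forall (k : nat) (i : 'I_d),
        P (X k @^-1` [set delta_mx 0 i]) = ((2 * d%:R)^-1)%:E /\
        P (X k @^-1` [set - delta_mx 0 i]) = ((2 * d%:R)^-1)%:E].

Definition walk (Omega : Type) (d : nat) (X : nat -> Omega -> 'rV[int]_d)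
    (n : nat) (w : Omega) : 'rV[int]_d :=
  \sum_(k < n) X k w.

Definition local_time (Omega : Type) (d : nat) (X : nat -> Omega -> 'rV[int]_d)
    (x : 'rV[int]_d) (n : nat) (w : Omega) : nat :=
  #|` fset_set [set k : nat | (0 < k <= n)%N /\ walk X k w = x] |.

(* Extended-real valued: +oo when x is visited infinitely often. *)
Definition total_local_time (R : realType) (Omega : Type) (d : nat)
    (X : nat -> Omega -> 'rV[int]_d) (x : 'rV[int]_d) (w : Omega) : \bar R :=
  counting [set k : nat | (1 <= k)%N /\ walk X k w = x].

(* The set counted by [Q] is finite for k > 0; [fset_set] would send the
   infinite set obtained for k = 0 to the empty one. *)
Definition Q (Omega : Type) (d : nat) (X : nat -> Omega -> 'rV[int]_d)
    (k n : nat) (w : Omega) : nat :=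
  #|` fset_set [set x : 'rV[int]_d | local_time X x n w = k] |.

Definition U (R : realType) (Omega : Type) (d : nat)
    (X : nat -> Omega -> 'rV[int]_d) (k n : nat) (w : Omega) : nat :=
  #|` fset_set [set j : nat |
        [/\ (0 < j <= n)%N,
            total_local_time R X (walk X j w) w = (k%:R)%:E &
            forall l : nat, (1 <= l < j)%N -> walk X j w <> walk X l w]] |.

(* [tailQ] is R(k,n) and [tailU] is V(k,n); for k > 0 both series have finitely
   many nonzero terms, so the limits exist. *)
Definition tailQ (R : realType) (Omega : Type) (d : nat)
    (X : nat -> Omega -> 'rV[int]_d) (k n : nat) (w : Omega) : R :=
  limn (fun m : nat => \sum_(k <= j < m) (Q X j n w)%:R : R).

Definition tailU (R : realType) (Omega : Type) (d : nat)
    (X : nat -> Omega -> 'rV[int]_d) (k n : nat) (w : Omega) : R :=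
  limn (fun m : nat => \sum_(k <= j < m) (U R X j n w)%:R : R).

Definition escape_prob (R : realType) (disp : measure_display)
    (Omega : measurableType disp) (P : probability Omega R) (d : nat)
    (X : nat -> Omega -> 'rV[int]_d) : R :=
  fine (P [set w | forall k : nat, (1 <= k)%N -> walk X k w <> 0]).

Definition mu (R : realType) (gamma : R) (t : nat) : R :=
  gamma * (1 - gamma) ^+ t.-1.

Definition lambda (R : realType) (gamma : R) : R := - (ln (1 - gamma))^-1.

Definition threshold (R : realType) (gamma B : R) (n : nat) : int :=
  Num.floor (lambda gamma * ln n%:R - lambda gamma * B * ln (ln n%:R)).

(* Supremum over positive integers t <= T; it is 0 if there are none, which
   for T = [threshold gamma B n] can only happen for finitely many n. *)
Definition sup_dev (R : realType) (T : int) (f : nat -> R) : R :=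
  sup [set `|f t - 1| | t in [set t : nat | (0 < t)%N /\ t%:Z <= T]].

(* Main.v *)
(** The process is described by the word of directions of its steps, so that
    finite-horizon probabilities are averages over words.

    Let h = 1 - gamma be the return probability.  By the strong Markov property
    the number of returns before time m is at least t with probability at most
    h^t, and nearly h^t once m is large; this uses the tail bound
    P(m < first return < oo) <= K / sqrt m, which follows from the local bound
    P(S_n = x) <= C n^(-3/2).

    The number of points visited at least t+1 times is compared with a sum of
    n window events: a point not visited during the previous m steps and
    revisited at least t times during the next m steps, m being a power of
    log n.  Windows at distance at least 2m are independent, so the variance is
    governed by nearby pairs of centres.  Pairs whose difference lies in a fixed
    finite set F contribute O(n h^t), because fresh visits to one point are more
    than m steps apart; for the other pairs both points are visited often with
    probability at most (h + eta)^(2t), where (h + eta)^4 <= h^3.  Chebyshev's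
    inequality, summed over the t with n h^t >= (log n)^2, is then summable along
    n = rho^k, and the counts V and R are monotone in n.  Finally
    U(t) = V(t) - V(t+1) and Q(t) = R(t) - R(t+1). *)

Require Import Defs.
From HB Require Import structures.
From mathcomp Require Import all_boot all_order all_algebra finmap.
From mathcomp Require Import all_classical all_reals all_analysis.
From mathcomp Require Import ring lra zify.

Set Implicit Arguments.
Unset Strict Implicit.
Unset Printing Implicit Defensive.

Import Order.TTheory GRing.Theory Num.Theory.
Import numFieldNormedType.Exports.

Local Open Scope ring_scope.


(** * Averages over uniform words *)

Section WordMean.
Variables (R : rcfType) (D : finType).

(** Why the squared logarithm: at [n = rho^k] the main term of Chebyshev's bound is of order
    [1/(n h^t)]. Over the admissible [t] these terms grow geometrically, so their sum is comparable
    with the largest one, at most [1/k^2]. The condition [B > 2] puts every [t <= t_n] into this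
    range, with any constant to spare. A cruder variance bound, with a factor [m] in front of
    [n h^t], would lose this exponent; hence the care with nearby pairs. The other pairs may carry a
    power of [m]: the inequality on [h + eta] leaves a factor [n^(-1/2)], which beats every power of
    [log n].

    V involves the infinite future, so the upper tail has to be uniform in the horizon up to which
    revisits are counted. The lower tail is proved for the horizon [n] itself, the worst one;
    monotonicity in the horizon then yields V and R together. The means of U and Q are those of V
    and R times the fixed factor [gamma], so relative errors survive the subtraction. *)

Fixpoint wmean (n : nat) (f : seq D -> R) : R :=
  if n is m.+1 then (#|D|%:R)^-1 * \sum_a wmean m (fun s => f (a :: s))
  else f [::].

Lemma wmean_le n f g :
  (forall s, size s = n -> f s <= g s) -> wmean n f <= wmean n g.
Proof.
elim: n f g => [|n IHn] f g fg /=; first exact: fg.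
rewrite ler_wpM2l ?invr_ge0 ?ler0n //; apply: ler_sum => a _.
by apply: IHn => s sn; apply: fg; rewrite /= sn.
Qed.

Lemma eq_wmean n f g :
  (forall s, size s = n -> f s = g s) -> wmean n f = wmean n g.
Proof.
by move=> fg; apply/eqP; rewrite eq_le !wmean_le // => s /fg ->.
Qed.

Lemma wmeanZ n c f : wmean n (fun s => c * f s) = c * wmean n f.
Proof.
elim: n f => [|n IHn] f //=.
under eq_bigr do rewrite IHn.
by rewrite -mulr_sumr mulrCA.
Qed.

Lemma wmeanD n f g : wmean n (fun s => f s + g s) = wmean n f + wmean n g.
Proof.
elim: n f g => [|n IHn] f g //=.
under eq_bigr do rewrite IHn.
by rewrite big_split mulrDr.
Qed.

Lemma wmeanB n f g : wmean n (fun s => f s - g s) = wmean n f - wmean n g.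
Proof.
rewrite wmeanD; congr (_ + _).
by rewrite -mulN1r -wmeanZ; apply: eq_wmean => s _; rewrite mulN1r.
Qed.

Lemma wmean_sum n (I : Type) (r : seq I) (Q : pred I) (F : I -> seq D -> R) :
  wmean n (fun s => \sum_(i <- r | Q i) F i s) = \sum_(i <- r | Q i) wmean n (F i).
Proof.
elim: r => [|i r IHr].
  rewrite big_nil -[RHS](mul0r (wmean n (fun=> 0))) -wmeanZ.
  by apply: eq_wmean => s _; rewrite big_nil mul0r.
rewrite big_cons; case: ifP => Qi; last first.
  by rewrite -IHr; apply: eq_wmean => s _; rewrite big_cons Qi.
by rewrite -IHr -wmeanD; apply: eq_wmean => s _; rewrite big_cons Qi.
Qed.

(** Independence of consecutive blocks, in the form of Fubini's theorem; the recursion on the first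
    letter makes it immediate. *)
Lemma wmean_cat m n f :
  wmean (m + n) f = wmean m (fun u => wmean n (fun v => f (u ++ v))).
Proof.
by elim: m f => [|m IHm] f //=; under eq_bigr do rewrite IHm.
Qed.

Lemma wmean_rcons n f :
  wmean n.+1 f = wmean n (fun s => (#|D|%:R)^-1 * \sum_a f (rcons s a)).
Proof.
elim: n f => [|n IHn] f //.
transitivity ((#|D|%:R)^-1 * \sum_a wmean n.+1 (fun s => f (a :: s))) => //.
by under eq_bigr do rewrite IHn.
Qed.

(** Time reversal preserves the uniform law. It turns the event that the present point was not
    visited recently into the absence of returns along a word. *)
Lemma wmean_rev n f : wmean n (fun s => f (rev s)) = wmean n f.
Proof.
elim: n f => [|n IHn] f //; rewrite wmean_rcons [RHS]/= wmeanZ wmean_sum.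
rewrite [RHS]/=; congr (_ * _); apply: eq_bigr => a _; rewrite -[RHS]IHn.
by apply: eq_wmean => s _; rewrite rev_rcons.
Qed.

Hypothesis D0 : (0 < #|D|)%N.

Lemma wmean_cst n c : wmean n (fun=> c) = c.
Proof.
elim: n => [|n IHn] //=; rewrite IHn sumr_const -[c *+ _]mulr_natl mulKf //.
by rewrite pnatr_eq0 -lt0n.
Qed.

Lemma wmean_ge0 n f : (forall s, size s = n -> 0 <= f s) -> 0 <= wmean n f.
Proof. by move=> f0; rewrite -(wmean_cst n 0); apply: wmean_le. Qed.

Lemma wmean_le_cst n f c : (forall s, size s = n -> f s <= c) -> wmean n f <= c.
Proof. by move=> fc; rewrite -[leRHS](wmean_cst n c); apply: wmean_le. Qed.

Definition seg (i l : nat) (s : seq D) := take l (drop i s).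

Lemma size_seg i l s : (i + l <= size s)%N -> size (seg i l s) = l.
Proof. by move=> il; rewrite /seg size_takel // size_drop; lia. Qed.

Lemma wmean_take m n f : (m <= n)%N -> wmean n (fun s => f (take m s)) = wmean m f.
Proof.
move=> mn; rewrite -(subnKC mn) wmean_cat; apply: eq_wmean => u um.
rewrite -[RHS](wmean_cst (n - m)); apply: eq_wmean => v _.
by rewrite take_size_cat.
Qed.

Lemma wmean_drop m n f : (m <= n)%N -> wmean n (fun s => f (drop m s)) = wmean (n - m) f.
Proof.
move=> mn; rewrite -[in LHS](subnKC mn) wmean_cat -[RHS](wmean_cst m).
apply: eq_wmean => u um; apply: eq_wmean => v _.
by rewrite drop_size_cat.
Qed.

Lemma wmean_seg i l n f : (i + l <= n)%N -> wmean n (fun s => f (seg i l s)) = wmean l f.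
Proof.
move=> iln; rewrite /seg (wmean_drop (fun s => f (take l s))); last by lia.
by rewrite wmean_take //; lia.
Qed.

Lemma wmean_split m n (F : seq D -> seq D -> R) : (m <= n)%N ->
  wmean n (fun s => F (take m s) (drop m s))
  = wmean m (fun u => wmean (n - m) (F u)).
Proof.
move=> mn; rewrite -[in LHS](subnKC mn) wmean_cat.
apply: eq_wmean => u um; apply: eq_wmean => v _.
by rewrite take_size_cat // drop_size_cat.
Qed.

Definition wprob n (A : seq D -> bool) : R := wmean n (fun s => (A s)%:R).

Lemma wprob_ge0 n A : 0 <= wprob n A.
Proof. by apply: wmean_ge0 => s _; rewrite ler0n. Qed.

Lemma wprob_le1 n A : wprob n A <= 1.
Proof. by apply: wmean_le_cst => s _; rewrite lern1 leq_b1. Qed.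

Lemma wprob_le n (A A' : seq D -> bool) :
  (forall s, size s = n -> A s -> A' s) -> wprob n A <= wprob n A'.
Proof.
move=> AA'; apply: wmean_le => s sn; rewrite ler_nat.
by case: (A s) (AA' s sn) => // ->.
Qed.

Lemma wprobU n (A A' : seq D -> bool) :
  wprob n (fun s => A s || A' s) <= wprob n A + wprob n A'.
Proof.
rewrite -wmeanD; apply: wmean_le => s _; rewrite -natrD ler_nat.
by case: (A s); case: (A' s).
Qed.

Lemma markov_wprob n f (c : R) : 0 < c -> (forall s, size s = n -> 0 <= f s) ->
  wprob n (fun s => c <= f s) <= wmean n f / c.
Proof.
move=> c0 f0; rewrite ler_pdivlMr // mulrC -wmeanZ; apply: wmean_le => s sn.
by case: (boolP (c <= f s)) => cf; rewrite ?mulr1 // mulr0; apply: f0.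
Qed.

Lemma chebyshev_wprob n f (e c : R) : 0 < c ->
  wprob n (fun s => c <= `|f s - e|) <= wmean n (fun s => (f s - e) ^+ 2) / c ^+ 2.
Proof.
move=> c0; apply: le_trans (markov_wprob _ _); last 2 first.
- by rewrite exprn_gt0.
- by move=> s _; rewrite sqr_ge0.
apply: wprob_le => s _; rewrite -(real_normK (num_real (f s - e))).
by move=> cf; rewrite lerXn2r ?nnegrE // ltW.
Qed.

End WordMean.

Arguments wmean {R D}.
Arguments wprob {R D}.

(** * Visits of the walk driven by a word, and what a local bound implies for them *)

Section Visits.
Variables (D : finType) (V : zmodType) (st : D -> V).
Implicit Types (A : pred V) (c x : V) (s u v : seq D).

Definition pos s : V := \sum_(a <- s) st a.

(* The walk starts at c; its position at time 0 is not counted. *)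
Fixpoint vis A c s : nat :=
  if s is a :: s' then (A (c + st a)%R + vis A (c + st a)%R s')%N else 0%N.

Definition ret s := vis (pred1 0) 0 s.

Lemma pos_cat u v : pos (u ++ v) = pos u + pos v.
Proof. by rewrite /pos big_cat. Qed.

Lemma pos_cons a s : pos (a :: s) = st a + pos s.
Proof. by rewrite /pos big_cons. Qed.

Lemma pos_rev s : pos (rev s) = pos s.
Proof. by rewrite /pos; apply: perm_big; rewrite perm_rev. Qed.

Lemma vis_cat A c u v : vis A c (u ++ v) = (vis A c u + vis A (c + pos u)%R v)%N.
Proof.
elim: u c => [|a u IHu] c /=; first by rewrite /pos big_nil addr0.
by rewrite IHu pos_cons addrA addnA.
Qed.

Lemma vis_take A c m s : (vis A c (take m s) <= vis A c s)%N.
Proof. by rewrite -{2}(cat_take_drop m s) vis_cat leq_addr. Qed.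

Lemma eq_vis A A' c c' s : (forall y, A (c + y) = A' (c' + y)) -> vis A c s = vis A' c' s.
Proof.
elim: s c c' => [|a s IHs] c c' AA' //=.
by rewrite AA' (IHs (c + st a) (c' + st a)) // => y; rewrite -!addrA AA'.
Qed.

Lemma vis_pred1_self x s : vis (pred1 x) x s = ret s.
Proof.
by apply: eq_vis => y /=; rewrite add0r -subr_eq0 addrC addKr.
Qed.

Lemma vis_predU A A' c s : (forall y, ~~ (A y && A' y)) ->
  vis (predU A A') c s = (vis A c s + vis A' c s)%N.
Proof.
move=> AA'; elim: s c => [|a s IHs] c //=.
rewrite IHs addnACA; congr (_ + _)%N; move: (AA' (c + st a)).
by rewrite /in_mem /=; case: (A _); case: (A' _).
Qed.

Lemma visE A c s : vis A c s = (\sum_(k < size s) A (c + pos (take k.+1 s))%R)%N.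
Proof.
elim: s c => [|a s IHs] c /=; first by rewrite big_ord0.
rewrite big_ord_recl /= take0 pos_cons {1}/pos big_nil addr0 IHs.
by congr (_ + _)%N; apply: eq_bigr => k _; rewrite pos_cons addrA.
Qed.

Lemma vis_gt0P A c s :
  reflect (exists2 k, (0 < k <= size s)%N & A (c + pos (take k s))) (0 < vis A c s)%N.
Proof.
rewrite visE lt0n sum_nat_eq0 negb_forall; apply: (iffP existsP) => [[k]|[k k1 Ak]].
  by rewrite eqb0 negbK => Ak; exists k.+1; rewrite ?ltn_ord.
have k2 : (k.-1 < size s)%N by lia.
by exists (Ordinal k2); rewrite /= eqb0 negbK prednK //; lia.
Qed.

Lemma ret_gt0P s :
  reflect (exists2 k, (0 < k <= size s)%N & pos (take k s) = 0) (0 < ret s)%N.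
Proof.
by apply: (iffP (vis_gt0P _ _ _)) => -[k k1 H]; exists k => //; move: H;
  rewrite /= add0r => /eqP.
Qed.

Section Prob.
Variable R : rcfType.
Hypothesis D0 : (0 < #|D|)%N.

Definition hit A c n : R := wprob n (fun s => 0 < vis A c s)%N.
Definition retp n : R := hit (pred1 0) 0 n.

Lemma retpE n : retp n = wprob n (fun s => 0 < ret s)%N.
Proof. by []. Qed.

Lemma wprob_vis_mono A c k m n : (m <= n)%N ->
  wprob m (fun s => k <= vis A c s)%N <= wprob n (fun s => k <= vis A c s)%N :> R.
Proof.
move=> mn; rewrite {1}/wprob -(wmean_take D0 _ mn) //.
by apply: wprob_le => s _ /leq_trans; apply; apply: vis_take.
Qed.

Lemma wprob_cons n (E : seq D -> bool) :
  wprob n.+1 E = (#|D|%:R)^-1 * \sum_a wprob n (fun s => E (a :: s)) :> R.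
Proof. by []. Qed.

Lemma eq_wprob n (E E' : seq D -> bool) :
  (forall s, size s = n -> E s = E' s) -> wprob n E = wprob n E' :> R.
Proof. by move=> EE'; apply: eq_wmean => s /EE' ->. Qed.

Lemma wprobT n (E : seq D -> bool) : (forall s, E s) -> wprob n E = 1 :> R.
Proof.
by move=> ET; rewrite -(wmean_cst D0 n 1); apply: eq_wmean => s _; rewrite ET.
Qed.

(** Strong Markov property by recursion on the first letter: at its first visit the walk restarts
    from a point of [A], and from there each further visit costs a factor [b]. *)
Lemma wprob_vis_geom A (b : R) :
  (forall y n, A y -> hit A y n <= b) -> 0 <= b ->
  forall n k c, wprob n (fun s => k < vis A c s)%N <= b ^+ k * hit A c n.
Proof.
move=> Ab b0; elim=> [|n IHn] k c.
  have hit0 : hit A c 0 = 0 by [].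
  by rewrite hit0 mulr0 /wprob.
rewrite /hit !wprob_cons mulrCA ler_wpM2l ?invr_ge0 // mulr_sumr.
apply: ler_sum => a _ /=; have [Aa|nAa] := boolP (A (c + st a)); last exact: IHn.
rewrite [X in _ * X]wprobT // mulr1.
case: k => [|k]; first by rewrite expr0 wprob_le1.
apply: le_trans (IHn k (c + st a)) _.
by rewrite exprSr ler_wpM2l ?exprn_ge0 // Ab.
Qed.

Lemma wprob_vis_geom1 A (b : R) k n c : A c ->
  (forall y n, A y -> hit A y n <= b) -> 0 <= b ->
  wprob n (fun s => k <= vis A c s)%N <= b ^+ k.
Proof.
move=> Ac Ab b0; case: k => [|k]; first by rewrite expr0 wprob_le1.
apply: le_trans (wprob_vis_geom Ab b0 n k c) _.
by rewrite exprSr ler_wpM2l ?exprn_ge0 // Ab.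
Qed.

(** Converse to the geometric bound: after the first hit of [x], each of the [k] further returns
    gets its own budget of [l] steps, and the walk restarts at [x] each time. *)
Lemma wprob_vis_lower x l k : forall m c,
  hit (pred1 x) c m * retp l ^+ k
    <= wprob (m + k * l) (fun s => k < vis (pred1 x) c s)%N.
Proof.
elim: k => [|k IHk] m c; first by rewrite expr0 mulr1 mul0n addn0.
elim: m c => [|m IHm] c.
  have hit0 : hit (pred1 x) c 0 = 0 by [].
  by rewrite hit0 mul0r wprob_ge0.
rewrite addSn /hit !wprob_cons -mulrA ler_wpM2l ?invr_ge0 // mulr_suml.
apply: ler_sum => a _ /=; have [/eqP ->|xa] := boolP (c + st a == x); last exact: IHm.
rewrite [X in X * _]wprobT // mul1r exprS.
have := IHk l x; rewrite /hit.
under eq_wprob do rewrite vis_pred1_self; rewrite -/(retp l).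
by move=> /le_trans; apply; apply: wprob_vis_mono; rewrite mulSn; lia.
Qed.

Lemma wprob_ret_lower l k n : (k * l <= n)%N ->
  retp l ^+ k <= wprob n (fun s => k <= ret s)%N.
Proof.
case: k => [|k] kl; first by rewrite expr0 wprobT.
rewrite exprS; apply: le_trans (wprob_vis_lower 0 l k l 0) _.
by apply: wprob_vis_mono; lia.
Qed.

Lemma retp_mono m n : (m <= n)%N -> retp m <= retp n.
Proof. exact: wprob_vis_mono. Qed.

Lemma wprob_ret_geom (h : R) n k : (forall n, retp n <= h) ->
  wprob n (fun s => k <= ret s)%N <= h ^+ k.
Proof.
move=> hh; apply: wprob_vis_geom1 => [|y m /eqP ->|] //=; last first.
  exact: le_trans (wprob_ge0 _ D0 0 _) (hh 0%N).
Qed.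

Lemma wmean_vis A c n :
  wmean n (fun s => (vis A c s)%:R) = \sum_(k < n) wprob k.+1 (fun s => A (c + pos s)) :> R.
Proof.
transitivity (wmean n (fun s => \sum_(k < n) (A (c + pos (take k.+1 s)))%:R : R)).
  by apply: eq_wmean => s sn; rewrite visE sn natr_sum.
rewrite wmean_sum; apply: eq_bigr => k _.
by rewrite (wmean_take D0 (fun s => (A (c + pos s))%:R)).
Qed.

Section Local.
Variables (K : R) (K0 : 0 <= K).
(** The local bound of order [k^(-3/2)] is written as a difference of consecutive inverse square
    roots, so that its sums telescope. *)
Definition isqrt n : R := (Num.sqrt n%:R)^-1.
Hypothesis local : forall k x,
  wprob k.+1 (fun s => pos s == x) <= K * (isqrt k.+1 - isqrt k.+2).

Lemma isqrt_ge0 n : 0 <= isqrt n.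
Proof. by rewrite invr_ge0 sqrtr_ge0. Qed.

Lemma sum_local c x m n : (m <= n)%N ->
  \sum_(m <= k < n) wprob k.+1 (fun s => c + pos s == x) <= K * isqrt m.+1.
Proof.
move=> mn; apply: (@le_trans _ _ (\sum_(m <= k < n) K * (isqrt k.+1 - isqrt k.+2))).
  apply: ler_sum => k _; apply: le_trans (local k (x - c)).
  by apply: wprob_le => s _; rewrite addrC -[X in _ == X](subrK c) (inj_eq (addIr c)).
rewrite -mulr_sumr ler_wpM2l //.
have -> : \sum_(m <= k < n) (isqrt k.+1 - isqrt k.+2) = isqrt m.+1 - isqrt n.+1.
  rewrite (telescope_sumr_eq (fun k => - isqrt k.+1)) //; first by rewrite opprK addrC.
  by move=> k _; rewrite opprK addrC.
by rewrite lerBlDr lerDl isqrt_ge0.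
Qed.

Lemma wmean_vis1_le c x n : wmean n (fun s => (vis (pred1 x) c s)%:R) <= K :> R.
Proof.
rewrite wmean_vis -(big_mkord xpredT (fun k => wprob k.+1 _)).
apply: le_trans (sum_local c x (leq0n n)) _.
by rewrite /isqrt sqrtr1 invr1 mulr1.
Qed.

(* The probability of a visit after time m is at most the expected number of
   such visits. *)
Lemma hit_tail c x m n : (m <= n)%N ->
  hit (pred1 x) c n <= hit (pred1 x) c m + K * isqrt m.+1.
Proof.
move=> mn.
apply: (@le_trans _ _ (wmean n (fun s => (0 < vis (pred1 x) c (take m s))%:R
     + ((vis (pred1 x) c s)%:R - (vis (pred1 x) c (take m s))%:R)))).
  apply: wmean_le => s _; rewrite -natrB ?vis_take // -natrD ler_nat.
  by have := vis_take (pred1 x) c m s; case: (vis _ _ (take _ _)); case: (vis _ _ s) => //; lia.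
rewrite wmeanD wmeanB (wmean_take D0 (fun s => (0 < vis (pred1 x) c s)%:R)) //.
rewrite (wmean_take D0 (fun s => (vis (pred1 x) c s)%:R)) //.
rewrite lerD2l !wmean_vis -!(big_mkord xpredT (fun k => wprob k.+1 _)).
by rewrite (big_cat_nat (leq0n m) mn) //= addrAC subrr add0r sum_local.
Qed.

Lemma retp_tail m n : retp n <= retp m + K * isqrt m.+1.
Proof.
have [mn|/ltnW nm] := leqP m n; first exact: hit_tail.
by apply: le_trans (retp_mono nm) _; rewrite lerDl mulr_ge0 ?isqrt_ge0.
Qed.

Fixpoint reach n : seq V :=
  if n is n'.+1 then 0 :: [seq st a + x | a <- enum D, x <- reach n'] else [:: 0].

Lemma pos_reach n s : (size s <= n)%N -> pos s \in reach n.
Proof.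
elim: n s => [|n IHn] [|a s] //=; rewrite ?/pos ?big_nil ?mem_head // => sn.
rewrite inE big_cons; apply/orP; right; apply/allpairsP.
by exists (a, pos s); rewrite mem_enum IHn.
Qed.

(** A point outside [reach m] cannot be hit within [m] steps, so only the tail after time [m]
    remains. *)
Lemma hit_far m n x : x \notin reach m -> hit (pred1 x) 0 n <= K * isqrt m.+1.
Proof.
move=> xm.
have h0 k : (k <= m)%N -> hit (pred1 x) 0 k <= 0.
  move=> km; apply: wmean_le_cst => // s sk.
  rewrite lern0 eqb0; apply/vis_gt0P => -[j j1 /=]; rewrite add0r => /eqP xE.
  by move: xm; rewrite -xE pos_reach // size_take; case: ltnP; lia.
have [mn|/ltnW nm] := leqP m n; last first.
  by apply: le_trans (h0 _ nm) _; rewrite mulr_ge0 ?isqrt_ge0.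
by apply: le_trans (hit_tail _ _ mn) _; rewrite gerDr h0.
Qed.

(** Markov's inequality: the expected number of returns is at most [K], while [k] returns occur
    within [k l] steps with probability at least [retp l ^+ k]. This will force the return
    probability below 1. *)
Lemma mul_retp_exp_le k l : k%:R * retp l ^+ k <= K.
Proof.
apply: (@le_trans _ _ (k%:R * wprob (k * l) (fun s => k <= ret s)%N)).
  by rewrite ler_wpM2l // wprob_ret_lower.
rewrite -wmeanZ; apply: le_trans (wmean_vis1_le 0 0 (k * l)).
by apply: wmean_le => s _; rewrite -natrM ler_nat -/(ret s); case: leqP; lia.
Qed.

End Local.
End Prob.
End Visits.

(** * Local bound in dimension at least three, from binomial coefficients *)

Lemma bin_sqr_le n j : (j <= n)%N -> ('C(n, j) ^ 2 * n.+1 <= 4 ^ n)%N.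
Proof.
elim/ltn_ind: n j => n IHn j jn.
wlog jh : j jn / (n <= 2 * j)%N => [hw|].
  have [/hw|jh] := leqP n (2 * j); first exact.
  by rewrite -bin_sub //; apply: hw; lia.
case: j jn jh => [|j] jn jh; first by have -> : n = 0%N by lia.
case: n IHn jn jh => [//|n] IHn jn jh.
have e1 : (n.+1 * 'C(n, j) = j.+1 * 'C(n.+1, j.+1))%N := mul_bin_diag n.+1 j.
(* Off the centre, [e1] compares with the row just above; this needs [n + 2 <= 2 (j + 1)] and fails
   for the central coefficient. *)
rewrite (expnS 4); have [lt|ge] := ltnP n.+1 (2 * j.+1).
  have IH := IHn n (leqnn _) j jn.
  rewrite -(leq_pmul2l (isT : 0 < j.+1 ^ 2)%N).
  rewrite mulnA -expnMn -e1 mulnCA mulnA.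
  rewrite (_ : _ * _ = (n.+1 * n.+2) * ('C(n, j) ^ 2 * n.+1))%N; last by lia.
  by rewrite leq_mul // -mulnn; nia.
(* The central coefficient is compared with the central one two rows above, where
   [(2j + 1)(2j + 3) <= 4 (j + 1)^2] suffices. *)
have nE : n = (2 * j).+1 by lia.
subst n; have e2 := mul_bin_diag (2 * j).+1 j; rewrite /= in e2.
have e3 : 'C((2 * j).+1, j) = 'C((2 * j).+1, j.+1).
  by rewrite -bin_sub; [congr 'C(_, _); lia|lia].
have IH := IHn (2 * j)%N (ltnW (leqnn _)) j ltac:(lia).
set c := 'C(2 * j, j) in IH e2; set c1 := 'C((2 * j).+2, j.+1) in e1 *.
have e4 : (j.+1 * c1 = 2 * (2 * j).+1 * c)%N.
  by move: e1 e2; rewrite e3; nia.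
rewrite -(leq_pmul2l (isT : 0 < j.+1 ^ 2)%N) .
rewrite mulnA -expnMn e4 (_ : _ * _ = (4 * (2 * j).+1 * (2 * j).+3) * (c ^ 2 * (2 * j).+1))%N; last by lia.
rewrite [X in (_ <= X)%N](_ : _ = 16 * j.+1 ^ 2 * 4 ^ (2 * j))%N; last by rewrite (expnS 4); lia.
by rewrite leq_mul // -mulnn; nia.
Qed.

Section Local.
Variable R : rcfType.

Lemma isqrt_sqr n : (isqrt R n.+1) ^+ 2 = n.+1%:R^-1.
Proof. by rewrite /isqrt exprVn sqr_sqrtr. Qed.

Lemma isqrt_gt0 n : 0 < isqrt R n.+1.
Proof. by rewrite invr_gt0 sqrtr_gt0 ltr0n. Qed.

Lemma isqrt_le1 n : isqrt R n.+1 <= 1.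
Proof.
by rewrite -(@expr_le1 _ 2) ?isqrt_ge0 // isqrt_sqr invf_le1 ?ler1n ?ltr0n.
Qed.

(** With [a] and [b] the two consecutive values, [a^2 - b^2 = a^2 b^2]; the constant 4 comes from
    [a^2 <= 2 b^2] and [a + b <= 2 a]. *)
Lemma isqrt_cube_le n :
  isqrt R n.+1 ^+ 3 <= 4%:R * (isqrt R n.+1 - isqrt R n.+2).
Proof.
have := isqrt_sqr n; have := isqrt_sqr n.+1.
have := isqrt_gt0 n; have := isqrt_gt0 n.+1.
set a := isqrt R n.+1; set b := isqrt R n.+2 => b0 a0 bE aE.
have n1 : n.+1%:R * a ^+ 2 = 1 by rewrite aE mulfV // pnatr_eq0.
have n2 : n.+2%:R * b ^+ 2 = 1 by rewrite bE mulfV // pnatr_eq0.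
have N1 : 1 <= n.+1%:R :> R by rewrite ler1n.
have nS : n.+2%:R = n.+1%:R + 1 :> R by rewrite natr1.
rewrite nS in n2; set m := n.+1%:R in n1 n2 N1.
have ab : a ^+ 2 - b ^+ 2 = a ^+ 2 * b ^+ 2 by nra.
have ba : a ^+ 2 <= 2 * b ^+ 2 by nra.
have le : b <= a by rewrite -(@ler_pXn2r _ 2) ?nnegrE ?ltW //; nra.
nra.
Qed.

(** The law of one-dimensional simple random walk after [k] steps. *)
Fixpoint walk1 (k : nat) (y : int) : R :=
  if k is k'.+1 then (walk1 k' (y - 1) + walk1 k' (y + 1)) / 2 else (y == 0)%:R.

Lemma walk1E k :
  (forall j : nat, walk1 k (j.*2%:Z - k%:Z) = 'C(k, j)%:R / 2 ^+ k) /\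
  (forall y, (forall j : nat, y <> j.*2%:Z - k%:Z) -> walk1 k y = 0).
Proof.
elim: k => [|k [IH1 IH2]]; split => /=.
- move=> [|j] /=; first by rewrite bin0 expr0 divr1.
  by rewrite bin0n expr0 divr1.
- by move=> y yj; case: eqP => // y0; case: (yj 0%N); rewrite y0.
- move=> j; have -> : j.*2%:Z - k.+1%:Z + 1 = j.*2%:Z - k%:Z by lia.
  rewrite IH1; case: j => [|j].
    rewrite IH2; last by move=> j; lia.
    by rewrite !bin0 add0r exprS; field; rewrite expf_neq0 ?pnatr_eq0.
  have -> : j.+1.*2%:Z - k.+1%:Z - 1 = j.*2%:Z - k%:Z by lia.
  by rewrite IH1 binS natrD exprS; field; rewrite expf_neq0 ?pnatr_eq0.
- move=> y yj; rewrite !IH2 ?addr0 ?mul0r // => j yE.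
    by apply: (yj j); lia.
  by apply: (yj j.+1); lia.
Qed.

Lemma walk1_bounds k y : 0 <= walk1 k y <= isqrt R k.+1.
Proof.
have [w1 w2] := walk1E k.
have [[j yE]|yj] : (exists j : nat, y = j.*2%:Z - k%:Z) \/
    (forall j : nat, y <> j.*2%:Z - k%:Z).
  have [ev|nev] := boolP ((0 <= y + k%:Z) && ~~ odd `|(y + k%:Z)%R|%N).
    left; exists (`|(y + k%:Z)%R|%N./2); move: (odd_double_half `|(y + k%:Z)%R|%N).
    by move: ev => /andP[? /negbTE ->]; lia.
  right=> j yE; move: nev; rewrite yE subrK lez_nat /= odd_double.
  by [].
- rewrite yE w1 divr_ge0 ?exprn_ge0 //=.
  have [jk|kj] := leqP j k; last by rewrite bin_small // mul0r isqrt_ge0.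
  rewrite -(@ler_pXn2r _ 2) ?nnegrE ?isqrt_ge0 ?divr_ge0 ?exprn_ge0 //.
  rewrite isqrt_sqr -[leRHS]div1r ler_pdivlMr ?ltr0n // expr_div_n mulrAC.
  rewrite ler_pdivrMr ?exprn_gt0 // mul1r.
  have -> : (2 ^+ k) ^+ 2 = (4 ^ k)%:R :> R by rewrite -exprM mulnC exprM natrX -natrX.
  by rewrite -natrX -natrM ler_nat bin_sqr_le.
- by rewrite w2 // lexx isqrt_ge0.
Qed.

Section Words.
Variable d : nat.
Hypothesis d0 : (0 < d)%N.

Let d0' : (0 < #|'I_d|)%N. Proof. by rewrite card_ord. Qed.
Let dR : d%:R != 0 :> R. Proof. by rewrite pnatr_eq0 -lt0n. Qed.

Lemma wmean_count_cons (i : 'I_d) n (f : nat -> R) :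
  d%:R * wmean n.+1 (fun c => f (count_mem i c)) =
    wmean n (fun c => f (count_mem i c).+1) +
    (d%:R - 1) * wmean n (fun c => f (count_mem i c)).
Proof.
rewrite /= card_ord mulVKf // (bigD1 i) //= eqxx; congr (_ + _).
rewrite (eq_bigr (fun=> wmean n (fun c => f (count_mem i c)))); last first.
  by move=> j /negbTE ji; apply: eq_wmean => s _; rewrite ji.
rewrite sumr_const -[_ *+ #|_|]mulr_natl cardC1 card_ord; congr (_ * _).
by rewrite -[in RHS](prednK d0) -natr1 addrK.
Qed.

(** The size-bias identity of the binomial law. Applied to inverse powers it gives the inverse
    moments of the number of steps along one coordinate, with no tail estimate. *)
Lemma wmean_count_size_bias (i : 'I_d) n (f : nat -> R) :
  d%:R * wmean n.+1 (fun c => (count_mem i c)%:R * f (count_mem i c)) =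
    n.+1%:R * wmean n (fun c => f (count_mem i c).+1).
Proof.
elim: n f => [|n IHn] f.
  by rewrite (wmean_count_cons i 0 (fun k => k%:R * f k)) /= mul0r mulr0 addr0.
rewrite (wmean_count_cons i n.+1 (fun k => k%:R * f k)).
transitivity (wmean n.+1 (fun c => f (count_mem i c).+1) +
  wmean n.+1 (fun c => (count_mem i c)%:R * f (count_mem i c).+1) +
  (d%:R - 1) * wmean n.+1 (fun c => (count_mem i c)%:R * f (count_mem i c))).
  congr (_ + _); rewrite -wmeanD; apply: eq_wmean => s _.
  by rewrite -natr1 mulrDl mul1r addrC.
have eB := IHn (fun k => f k.+1); have eC := IHn f.
have eA := wmean_count_cons i n (fun k => f k.+1).
cbv beta in eA, eB, eC; move: eA eB eC.
set A := wmean n.+1 _; set B := wmean n.+1 _; set C := wmean n.+1 _.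
set E := wmean n _; set F := wmean n _ => eA eB eC.
apply: (mulfI dR); rewrite -[n.+2%:R]natr1.
transitivity (d%:R * A + d%:R * B + (d%:R - 1) * (d%:R * C)); first by ring.
rewrite eB eC; transitivity (d%:R * A + n.+1%:R * (E + (d%:R - 1) * F)); first by ring.
by rewrite -eA; ring.
Qed.

Lemma wmean_inv_count (i : 'I_d) n :
  wmean n (fun c => (count_mem i c).+1%:R^-1) <= d%:R / n.+1%:R :> R.
Proof.
rewrite ler_pdivlMr ?ltr0n // mulrC.
rewrite -(wmean_count_size_bias i n (fun k => k%:R^-1)).
rewrite ler_piMr ?ler0n //; apply: wmean_le_cst => // s _.
by case: (count_mem i s) => [|k]; rewrite ?mul0r ?ler01 // mulfV ?pnatr_eq0.
Qed.

(** The square of the inverse is at most [2 / ((k + 1)(k + 2))], to which size biasing applies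
    twice. *)
Lemma wmean_inv_count_sqr (i : 'I_d) n :
  wmean n (fun c => (count_mem i c).+1%:R^-1 ^+ 2)
    <= 2 * d%:R ^+ 2 / n.+1%:R ^+ 2 :> R.
Proof.
apply: (@le_trans _ _ (2 * wmean n (fun c => ((count_mem i c).+1%:R * (count_mem i c).+2%:R)^-1))).
  rewrite -wmeanZ; apply: wmean_le => s _; set k := count_mem i s.
  rewrite expr2 -invfM -[leLHS]mul1r ler_pdivrMr ?mulr_gt0 ?ltr0n //.
  rewrite mulrAC ler_pdivlMr ?mulr_gt0 ?ltr0n //.
  rewrite -[k.+2%:R]natr1; have : 0 < k.+1%:R :> R by rewrite ltr0n.
  have : 1 <= k.+1%:R :> R by rewrite ler1n.
  by nra.
rewrite -mulrA ler_wpM2l // ler_pdivlMr ?exprn_gt0 ?ltr0n // mulrC expr2 -mulrA.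
rewrite -(wmean_count_size_bias i n (fun k => (k%:R * k.+1%:R)^-1)) mulrCA expr2.
rewrite ler_wpM2l ?ler0n //.
apply: (@le_trans _ _ (n.+1%:R * wmean n.+1 (fun c => (count_mem i c).+1%:R^-1))).
  rewrite ler_wpM2l ?ler0n //; apply: wmean_le => s _.
  case: (count_mem i s) => [|k]; first by rewrite mul0r invr_ge0 ler0n.
  by rewrite invfM mulVKf // pnatr_eq0.
apply: (@le_trans _ _ (n.+2%:R * wmean n.+1 (fun c => (count_mem i c).+1%:R^-1))).
  by apply: ler_wpM2r; rewrite ?ler_nat //; apply: wmean_ge0 => // s _; rewrite invr_ge0.
by rewrite mulrC -ler_pdivlMr ?ltr0n // wmean_inv_count.
Qed.

Definition lstep (a : 'I_d * bool) : 'rV[int]_d :=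
  if a.2 then delta_mx 0 a.1 else - delta_mx 0 a.1.

(** The words on the right name the coordinate moved at each step. Given them, the coordinates are
    independent one-dimensional walks whose lengths are the letter counts. *)
Lemma wprob_pos_walk1 n (x : 'rV[int]_d) :
  wprob n (fun s => pos lstep s == x) =
  wmean n (fun c => \prod_i walk1 (count_mem i c) (x 0 i)).
Proof.
elim: n x => [|n IHn] x.
  rewrite /wprob /= /pos big_nil; have [<-|x0] := eqVneq.
    by rewrite big1 // => i _; rewrite mxE.
  have [i xi] : exists i, x 0 i != 0.
    apply/existsP; apply: contraNT x0; rewrite negb_exists => /forallP xi.
    by apply/eqP/rowP => i; move: (xi i); rewrite negbK mxE => /eqP ->.
  by rewrite (bigD1 i) //= (negbTE xi) mul0r.
rewrite /wprob /= card_prod card_ord card_bool natrM invfM -mulrA; congr (_ * _).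
transitivity (2^-1 * \sum_i \sum_b wmean n (fun s => (pos lstep ((i, b) :: s) == x)%:R) : R).
  by rewrite pair_bigA; congr (_ * _); apply: eq_bigr => -[i b].
rewrite mulr_sumr; apply: eq_bigr => i _; rewrite big_bool /=.
have e b : wmean n (fun s => (pos lstep ((i, b) :: s) == x)%:R)
    = wprob n (fun s => pos lstep s == x - lstep (i, b)) :> R.
  by apply: eq_wmean => s _; rewrite pos_cons (eq_sym (pos _ _) (x - _)) subr_eq (eq_sym x) addrC.
rewrite !e !IHn -wmeanD -wmeanZ; apply: eq_wmean => c _.
have eqp (y : 'rV[int]_d) : (forall j, j != i -> y 0 j = x 0 j) ->
    \prod_j walk1 (count_mem j c) (y 0 j)
    = walk1 (count_mem i c) (y 0 i) * \prod_(j | j != i) walk1 (count_mem j c) (x 0 j).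
  by move=> yx; rewrite (bigD1 i) //=; congr (_ * _); apply: eq_bigr => j /yx ->.
rewrite !eqp; last 2 first.
- by move=> j /negbTE ji; rewrite !mxE eqxx ji /= oppr0 addr0.
- by move=> j /negbTE ji; rewrite !mxE eqxx ji /= oppr0 subr0.
rewrite [RHS](bigD1 i) //= eqxx /lstep /= !mxE !eqxx /= opprK.
rewrite -mulrDl mulrA [_^-1 * _]mulrC; congr (_ * _).
by apply: eq_bigr => j /negbTE ji; rewrite eq_sym ji.
Qed.

(** The product is at most the cube of its largest factor, which is one of the summands. Here the
    dimension yields the summable decay [n^(-3/2)]. *)
Lemma prod_le_sum_cube (a : 'I_d -> R) : (2 < d)%N ->
  (forall i, 0 <= a i <= 1) -> \prod_i a i <= \sum_i a i ^+ 3.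
Proof.
move=> d2 a01; pose i0 := Ordinal d0.
pose m := [arg max_(i > i0) a i]%O.
have mP i : a i <= a m by rewrite /m; case: arg_maxP => // j _ /(_ i); apply.
apply: (@le_trans _ _ (a m ^+ d)).
  rewrite -[in leRHS](card_ord d) -prodr_const; apply: ler_prod => i _.
  by rewrite mP andbT; case/andP: (a01 i).
apply: (@le_trans _ _ (a m ^+ 3)).
  by case/andP: (a01 m) => am0 am1; rewrite ler_wiXn2l.
rewrite (bigD1 m) //= lerDl; apply: sumr_ge0 => i _.
by rewrite exprn_ge0 //; case/andP: (a01 i).
Qed.

(** Each of the [d] coordinates contributes at most [2 d^2 q^3] with [q = isqrt R k.+1]; the
    remaining factor 4 is that of [isqrt_cube_le]. *)
Lemma local_bound k (x : 'rV[int]_d) : (2 < d)%N ->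
  wprob k.+1 (fun s => pos lstep s == x)
    <= (8 * d%:R ^+ 3) * (isqrt R k.+1 - isqrt R k.+2).
Proof.
move=> d2; rewrite wprob_pos_walk1.
apply: (@le_trans _ _ (wmean k.+1 (fun c => \sum_(i < d) isqrt R (count_mem i c).+1 ^+ 3))).
  apply: wmean_le => c _.
  apply: (@le_trans _ _ (\prod_i isqrt R (count_mem i c).+1)).
    by apply: ler_prod => i _; apply: walk1_bounds.
  by apply: prod_le_sum_cube => // i; rewrite isqrt_ge0 isqrt_le1.
rewrite wmean_sum; set q := isqrt R k.+1.
apply: (@le_trans _ _ (\sum_(i < d) 2 * d%:R ^+ 2 * q ^+ 3)); last first.
  rewrite sumr_const card_ord -[_ *+ d]mulr_natl.
  have -> : d%:R * (2 * d%:R ^+ 2 * q ^+ 3) = 2 * d%:R ^+ 3 * q ^+ 3 by ring.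
  have -> : 8 * d%:R ^+ 3 * (q - isqrt R k.+2)
     = 2 * d%:R ^+ 3 * (4 * (q - isqrt R k.+2)) by ring.
  by rewrite ler_wpM2l ?mulr_ge0 ?exprn_ge0 // isqrt_cube_le.
apply: ler_sum => i _.
have q0 : 0 < q by exact: isqrt_gt0.
have qE : q ^+ 2 = k.+1%:R^-1 by exact: isqrt_sqr.
(* The inverse moment of order 3/2 is interpolated between those of orders 1 and 2:
   [a^3 <= q a^2 / 2 + a^4 / (2 q)], optimal at [a = q], the expected order of magnitude. *)
apply: (@le_trans _ _ (wmean k.+1 (fun c => q / 2 * (count_mem i c).+1%:R^-1 +
     (2 * q)^-1 * (count_mem i c).+1%:R^-1 ^+ 2))).
  apply: wmean_le => c _; rewrite -(isqrt_sqr (count_mem i c)).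
  set a := isqrt R _; rewrite invfM.
  have a0 : 0 < a by exact: isqrt_gt0.
  have -> : q / 2 * a ^+ 2 + 2^-1 / q * a ^+ 2 ^+ 2 = a ^+ 3 + a ^+ 2 / (2 * q) * (q - a) ^+ 2.
    by field; rewrite gt_eqF.
  by rewrite lerDl mulr_ge0 ?sqr_ge0 // divr_ge0 ?sqr_ge0 // mulr_ge0 // ltW.
rewrite wmeanD !wmeanZ.
have e1 : wmean k.+1 (fun c => (count_mem i c).+1%:R^-1) <= d%:R * q ^+ 2.
  apply: le_trans (wmean_inv_count i k.+1) _.
  by rewrite qE ler_wpM2l // lef_pV2 ?posrE ?ltr0n // ler_nat.
have e2 : wmean k.+1 (fun c => (count_mem i c).+1%:R^-1 ^+ 2) <= 2 * d%:R ^+ 2 * q ^+ 4.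
  apply: le_trans (wmean_inv_count_sqr i k.+1) _.
  rewrite ler_wpM2l ?mulr_ge0 ?exprn_ge0 // (_ : 4%N = (2 * 2)%N) // exprM qE -exprVn.
  by rewrite lerXn2r ?nnegrE ?invr_ge0 // lef_pV2 ?posrE ?ltr0n // ler_nat.
apply: (@le_trans _ _ (q / 2 * (d%:R * q ^+ 2) + (2 * q)^-1 * (2 * d%:R ^+ 2 * q ^+ 4))).
  apply: lerD; apply: ler_wpM2l => //; first by rewrite divr_ge0 ?ltW.
  by rewrite invr_ge0 mulr_ge0 ?ltW.
have -> : q / 2 * (d%:R * q ^+ 2) + (2 * q)^-1 * (2 * d%:R ^+ 2 * q ^+ 4)
   = (d%:R / 2 + d%:R ^+ 2) * q ^+ 3 by field; rewrite gt_eqF.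
rewrite ler_wpM2r ?exprn_ge0 ?ltW //.
have : 1 <= d%:R :> R by rewrite ler1n.
by nra.
Qed.

End Words.
End Local.

(** * Variance of a sum over sliding blocks *)

Section BlockVariance.
Variables (R : rcfType) (D : finType).
Hypothesis D0 : (0 < #|D|)%N.

Lemma seg_take i l m (s : seq D) : (i + l <= m)%N -> seg i l (take m s) = seg i l s.
Proof. by move=> ilm; rewrite /seg !take_drop take_takel // addnC. Qed.

Lemma seg_drop i l m (s : seq D) : seg i l (drop m s) = seg (m + i) l s.
Proof. by rewrite /seg drop_drop addnC. Qed.

Variables (f : seq D -> R) (M n : nat).
Hypothesis f0 : forall s, 0 <= f s.
Let e := wmean M f.
Let g l := wmean (2 * M) (fun s => f (seg 0 M s) * f (seg l M s)).

Let g0 l : 0 <= g l.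
Proof. by apply: wmean_ge0 => // s _; rewrite mulr_ge0. Qed.

Let sum_shift i : \sum_(j < n) (if (i <= j < i + M)%N then g (j - i) else 0) <= \sum_(l < M) g l.
Proof.
apply: (@le_trans _ _ (\sum_(j < n) \sum_(l < M) (if (j == i + l :> nat)%N then g l else 0))).
  apply: ler_sum => j _; case: ifP => [ij|_]; last first.
    by apply: sumr_ge0 => l _; case: ifP.
  have lM : (j - i < M)%N by lia.
  rewrite (bigD1 (Ordinal lM)) //= ifT; last by apply/eqP; lia.
  by rewrite lerDl; apply: sumr_ge0 => l _; case: ifP.
rewrite exchange_big; apply: ler_sum => l _.
have [iln|nil] := ltnP (i + l) n.
  rewrite (bigD1 (Ordinal iln)) //= eqxx big1 ?addr0 // => j ji.
  by case: eqP => // jE; case/negP: ji; apply/eqP/val_inj.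
rewrite big1 // => j _; case: eqP => // jE.
by have := ltn_ord j; rewrite jE ltnNge nil.
Qed.

Let cov i j : (i <= j < n)%N ->
  wmean (n + M) (fun s => f (seg i M s) * f (seg j M s)) - e ^+ 2
    <= if (i <= j < i + M)%N then g (j - i) else 0.
Proof.
move=> /andP[ij jn]; pose F s := f (seg 0 M s) * f (seg (j - i) M s).
have -> : wmean (n + M) (fun s => f (seg i M s) * f (seg j M s)) = wmean (n + M - i) F.
  rewrite -(wmean_drop D0 F); last by lia.
  by apply: eq_wmean => s _; rewrite /F !seg_drop addn0 subnKC.
rewrite ij /=; case: ltnP => jM.
  rewrite lerBlDr -[leLHS]addr0 lerD ?sqr_ge0 // /g -/F.
  have E k : (j - i + M <= k)%N -> wmean k F = wmean (j - i + M) F.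
    move=> kM; rewrite -(wmean_take D0 F kM); apply: eq_wmean => s _.
    by rewrite /F !seg_take //; lia.
  by rewrite !E //; lia.
have -> : wmean (n + M - i) F = e ^+ 2; last by rewrite subrr.
pose F2 (u v : seq D) := f u * f (seg (j - i - M) M v).
transitivity (wmean (n + M - i) (fun s => F2 (take M s) (drop M s))).
  by apply: eq_wmean => s _; rewrite /F /F2 seg_drop subnKC ?/seg ?drop0 //; lia.
rewrite wmean_split; last by lia.
rewrite expr2 -wmeanZ; apply: eq_wmean => s _.
by rewrite wmeanZ mulrC wmean_seg //; lia.
Qed.

(** Blocks whose starts differ by at least [M] have covariance zero. For the others the square of
    the mean is dropped and stationarity leaves only the shift [l < M]; the factor 2 counts both
    orders of a pair. *)
Lemma block_variance :
  wmean (n + M) (fun s => (\sum_(j < n) f (seg j M s) - n%:R * wmean M f) ^+ 2)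
  <= 2 * n%:R * \sum_(l < M) wmean (2 * M) (fun s => f (seg 0 M s) * f (seg l M s)).
Proof.
rewrite -/e; pose c i j := wmean (n + M) (fun s => f (seg i M s) * f (seg j M s)) - e ^+ 2.
have -> : wmean (n + M) (fun s => (\sum_(j < n) f (seg j M s) - n%:R * e) ^+ 2) =
    \sum_(i < n) \sum_(j < n) c i j.
  transitivity (wmean (n + M) (fun s => \sum_(i < n) \sum_(j < n)
      ((f (seg i M s) - e) * (f (seg j M s) - e)))).
    apply: eq_wmean => s _; rewrite expr2.
    have -> : \sum_(j < n) f (seg j M s) - n%:R * e = \sum_(j < n) (f (seg j M s) - e).
      by rewrite sumrB sumr_const card_ord -[e *+ _]mulr_natl.
    by rewrite mulr_suml; apply: eq_bigr => i _; rewrite mulr_sumr.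
  rewrite wmean_sum; apply: eq_bigr => i _; rewrite wmean_sum; apply: eq_bigr => j _.
  transitivity (wmean (n + M) (fun s => f (seg i M s) * f (seg j M s) -
     (e * f (seg i M s) + e * f (seg j M s) - e ^+ 2))).
    by apply: eq_wmean => s _; ring.
  rewrite wmeanB wmeanB wmeanD !wmeanZ wmean_cst //.
  rewrite !(wmean_seg D0) ?leq_add2r ?(ltnW (ltn_ord _)) // -/e /c; ring.
pose u i j := if (i <= j < i + M)%N then g (j - i) else 0.
have u0 i j : 0 <= u i j by rewrite /u; case: ifP.
apply: (@le_trans _ _ (\sum_(i < n) \sum_(j < n) (u i j + u j i))).
  apply: ler_sum => i _; apply: ler_sum => j _.
  have [ij|/ltnW ji] := leqP i j.
    by apply: le_trans (cov _) _; [rewrite ij ltn_ord|rewrite -/(u i j) lerDl].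
  rewrite /c; under eq_wmean do rewrite mulrC.
  by apply: le_trans (cov _) _; [rewrite ji ltn_ord|rewrite -/(u j i) lerDr].
under eq_bigr do rewrite big_split /=.
rewrite big_split /= [X in _ + X]exchange_big /= -mulr2n -[_ *+ 2]mulr_natl -mulrA.
rewrite ler_wpM2l // mulr_natl -[in leRHS](card_ord n) -sumr_const.
by apply: ler_sum => i _; apply: sum_shift.
Qed.

End BlockVariance.

(** * Window events, their second moment, and their comparison with visited points *)

Section Window.
Variables (R : rcfType) (D : finType) (V : zmodType) (st : D -> V).
Hypothesis D0 : (0 < #|D|)%N.
Local Notation ret := (ret st).
Local Notation pos := (pos st).
Local Notation vis := (vis st).
Implicit Types (s u v : seq D) (t m n : nat).

(* The words have length 2m; the event concerns the position at time m. *)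
Definition window t m s : bool :=
  (ret (rev (take m s)) == 0)%N && (t <= ret (drop m s))%N.

Definition window_count t m n s : nat := (\sum_(j < n) window t m (seg j (2 * m) s))%N.

Definition window_mean t m : R := wprob (2 * m) (window t m).

(** The two halves of the word are independent, and reversing the first half turns freshness into
    the absence of a return. *)
Lemma window_meanE t m :
  window_mean t m = (1 - retp st R m) * wprob m (fun s => t <= ret s)%N.
Proof.
pose F u v : R := (ret (rev u) == 0)%N%:R * (t <= ret v)%N%:R.
transitivity (wmean (2 * m) (fun s => F (take m s) (drop m s))).
  by apply: eq_wmean => s _; rewrite /window /F -natrM mulnb.
rewrite wmean_split; last by lia.
rewrite (_ : 2 * m - m = m)%N; last by lia.
transitivity (wmean m (fun u => wprob m (fun s => t <= ret s)%N * (ret (rev u) == 0)%N%:R) : R).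
  by apply: eq_wmean => u _; rewrite wmeanZ mulrC.
rewrite wmeanZ mulrC; congr (_ * _).
rewrite (wmean_rev m (fun u => (ret u == 0)%N%:R)) retpE -[X in X - _](wmean_cst D0 m 1) -wmeanB.
apply: eq_wmean => s _; rewrite lt0n.
by case: (_ == _); rewrite /= ?subr0 ?subrr.
Qed.

Lemma take_seg m j k s : (k <= m)%N -> take k (seg j m s) = seg j k s.
Proof. by move=> km; rewrite /seg take_takel. Qed.

Lemma drop_seg m j k s : (k <= m)%N -> drop k (seg j m s) = seg (j + k) (m - k) s.
Proof. by move=> km; rewrite /seg -{1}(subnK km) -take_drop drop_drop addnC. Qed.

Lemma window_seg t m j s : window t m (seg j (2 * m) s) =
  (ret (rev (seg j m s)) == 0)%N && (t <= ret (seg (j + m) m s))%N.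
Proof.
rewrite /window take_seg ?drop_seg; [|lia|lia].
by rewrite (_ : 2 * m - m = m)%N; last by lia.
Qed.

(** If the walk was at the same point [k] steps earlier, the last [k] steps sum to zero, and the
    reversed block returns at its [k]-th step. *)
Lemma pos_take_fresh j m k s : (0 < k <= m)%N -> (j + m <= size s)%N ->
  ret (rev (seg j m s)) = 0%N -> pos (take (j + m) s) <> pos (take (j + m - k) s).
Proof.
move=> /andP[k0 km] js fr E.
have : (0 < ret (rev (seg j m s)))%N; last by rewrite fr.
apply/ret_gt0P; exists k; first by rewrite k0 size_rev size_seg.
rewrite take_rev pos_rev size_seg //.
have jE : (j + m = (j + m - k) + k)%N by lia.
move: E; rewrite {1}jE takeD pos_cat.
have -> : drop (m - k) (seg j m s) = take k (drop (j + m - k) s).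
  by rewrite drop_seg ?leq_subr // /seg subKn // addnBA.
by move/eqP; rewrite -subr_eq0 addrAC subrr add0r => /eqP.
Qed.

Lemma sum_exclusive_le1 n (b : nat -> bool) :
  (forall i j, (i < j < n)%N -> ~~ (b i && b j)) -> (\sum_(i < n) b i <= 1)%N.
Proof.
elim: n b => [|n IHn] b bb; first by rewrite big_ord0.
rewrite big_ord_recr /=; have [bn|nbn] := boolP (b n).
  rewrite big1 // => i _; have := bb i n; rewrite ltn_ord ltnSn bn andbT => /(_ isT).
  by case: (b i).
by rewrite addn0 IHn // => i j ij; apply: bb; lia.
Qed.

(* Two fresh visits to the same point are more than m steps apart. *)
Lemma sum_fresh_le2 m (y : V) s : (3 * m <= size s)%N ->
  (\sum_(l < 2 * m) ((ret (rev (seg l m s)) == 0) && (pos (take (l + m) s) == y)%R) <= 2)%N.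
Proof.
move=> ms; pose b l := (ret (rev (seg l m s)) == 0)%N && (pos (take (l + m) s) == y)%R.
(* Two centres in the same half differ by less than [m], so each half holds at most one fresh visit
   to [y]. *)
have half a : (a <= m)%N -> (\sum_(l < m) b (a + l) <= 1)%N.
  move=> am; apply: (@sum_exclusive_le1 m (fun l => b (a + l)%N)) => i j /andP[ij jm]; rewrite /b.
  apply/negP => /andP[/andP[_ /eqP yi] /andP[/eqP fr /eqP yj]].
  have jim : (0 < j - i <= m)%N by lia.
  have ajm : (a + j + m <= size s)%N by lia.
  have := pos_take_fresh jim ajm fr; apply; rewrite yj -yi.
  by congr (pos (take _ s)); lia.
rewrite -(big_mkord xpredT (fun l => b l : nat)) mul2n -addnn.
rewrite (big_cat_nat (leq0n m) (leq_addr m m)) /= big_mkord.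
have -> : (\sum_(m <= l < m + m) b l = \sum_(l < m) b (m + l))%N.
  by rewrite -{1}[m]add0n big_addn addnK big_mkord; apply: eq_bigr => l _; rewrite addnC.
exact: (leq_add (half 0%N _) (half m _)).
Qed.

(** A position depends only on the letter counts. Indexing by counts gives polynomially many
    candidates for the difference of two centres, where words would give exponentially many. *)
Definition encode n (c : {ffun D -> 'I_n.+1}) : V := \sum_a st a *+ c a.

Lemma encode_surj n s : (size s <= n)%N -> exists c : {ffun D -> 'I_n.+1}, encode c = pos s.
Proof.
move=> sn; exists [ffun a => inord (count_mem a s)]; rewrite /encode.
transitivity (\sum_a st a *+ count_mem a s).
  apply: eq_bigr => a _; rewrite ffunE inordK //.
  by rewrite ltnS (leq_trans (count_size _ _)).
elim: s {sn} => [|b s IHs]; first by rewrite /pos big_nil big1.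
rewrite pos_cons -IHs; under eq_bigr do rewrite /= mulrnDr.
rewrite big_split /=; congr (_ + _); rewrite (bigD1 b) //= eqxx big1 ?addr0 //.
by move=> a /negbTE ab; rewrite eq_sym ab.
Qed.

Definition pair0 (x : V) : pred V := predU (pred1 0) (pred1 x).

Section PairBound.
Variables (h eta : R) (F : seq V).
Hypothesis h_ge : forall n, retp st R n <= h.
Hypothesis eta0 : 0 <= eta.
Hypothesis F0 : 0 \in F.
Hypothesis F_far : forall x n, x \notin F ->
  hit st R (pred1 x) 0 n <= eta /\ hit st R (pred1 (- x)) 0 n <= eta.

Lemma h_ge0 : 0 <= h.
Proof. exact: le_trans (wprob_ge0 _ D0 0 _) (h_ge 0%N). Qed.

Lemma hit_predU (A A' : pred V) c n :
  hit st R (predU A A') c n <= hit st R A c n + hit st R A' c n.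
Proof.
apply: le_trans (wprobU _ _ _ _); apply: wprob_le => s _.
move=> /vis_gt0P[k ks /orP[Ak|Ak]]; apply/orP; [left|right];
  by apply/vis_gt0P; exists k.
Qed.

(** From either point the walk returns with probability at most [h] and crosses to the other with
    probability at most [eta], so visits to the pair obey one geometric bound. The two signs in
    [F_far] serve the two crossings. *)
Lemma wprob_two_points x n k : x \notin F ->
  wprob n (fun s => k <= vis (pair0 x) 0 s)%N <= (h + eta) ^+ k.
Proof.
move=> xF; apply: wprob_vis_geom1 => //=; last by rewrite addr_ge0 ?h_ge0.
  by apply/orP; left; exact: eqxx.
move=> y m /orP[/eqP ->|/eqP ->]; apply: le_trans (hit_predU _ _ _ _) _.
  by rewrite lerD //; [exact: h_ge|exact: (F_far m xF).1].
rewrite addrC lerD //.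
  by apply: le_trans (h_ge m); apply: wprob_le => s _; rewrite vis_pred1_self.
apply: le_trans (F_far m xF).2; apply: wprob_le => s _.
rewrite (@eq_vis _ _ _ (pred1 0) (pred1 (- x)) x 0) // => z /=.
by rewrite add0r -subr_eq0 subr0 -[in RHS]subr_eq0 opprK addrC.
Qed.

(** The second centre lies at some [encode c] relative to the first. If this difference is in [F],
    the fresh visits to each such point number at most two. Otherwise both points are visited [t]
    times after time [m], an event charged to the sum over all [c]. *)
Lemma window_pair_pointwise t m s : size s = (4 * m)%N ->
  (\sum_(l < 2 * m) window t m (seg 0 (2 * m) s) * window t m (seg l (2 * m) s)
   <= 2 * size F * (t <= ret (seg m m s)) +
     \sum_(l < 2 * m) \sum_(c : {ffun D -> 'I_(2 * m).+1} | encode c \notin F)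
        (2 * t <= vis (pair0 (encode c)) 0%R (drop m s)))%N.
Proof.
move=> sm; pose v := drop m s.
apply: (@leq_trans (\sum_(l < 2 * m) ((t <= ret (seg m m s)) * \sum_(y <- F)
     ((ret (rev (seg l m s)) == 0) && (pos (take (l + m) s) == pos (take m s) + y)%R)
  + \sum_(c : {ffun D -> 'I_(2 * m).+1} | encode c \notin F)
        (2 * t <= vis (pair0 (encode c)) 0%R (drop m s))))).
  apply: leq_sum => l _; rewrite !window_seg add0n mulnb.
  case: (_ == 0)%N => //=; have [t1|] //= := leqP t (ret (seg m m s)).
  have [fr|] //= := boolP (ret (rev (seg l m s)) == 0)%N.
  have [t2|] //= := leqP t (ret (seg (l + m) m s)); rewrite mul1n.
  have lm : (size (take l v) <= 2 * m)%N.
    by rewrite size_take; case: ltnP => // ?; have := ltn_ord l; lia.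
  have [c cE] := encode_surj lm.
  have posE : pos (take (l + m) s) = pos (take m s) + encode c.
    by rewrite addnC takeD pos_cat cE.
  have [cF|cF] := boolP (encode c \in F).
    rewrite (big_rem _ cF) /= posE eqxx; lia.
  rewrite (bigD1 c) //= addnCA addn_gt0 lt0b; apply/orP; left.
  have x0 : encode c != 0 by apply: contraNneq cF => ->.
  rewrite vis_predU; last first.
    by move=> z /=; apply/negP => /andP[/eqP -> /eqP zE]; rewrite -zE eqxx in x0.
  rewrite mul2n -addnn leq_add //.
    by apply: leq_trans t1 _; rewrite /seg -/v; apply: vis_take.
  (* After [l] letters of [v] the walk stands at [encode c], so the returns of the second window are
     visits to that point. *)
  apply: leq_trans t2 _; rewrite -/v -[in X in (_ <= X)%N](cat_take_drop l v) vis_cat add0r -cE.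
  rewrite vis_pred1_self; apply: leq_trans (leq_addl _ _).
  by rewrite /seg -drop_drop -/v; apply: vis_take.
rewrite big_split leq_add //= -big_distrr /= [leqRHS]mulnC leq_mul2l; apply/orP; right.
rewrite exchange_big /= -sum1_size big_distrr /=.
apply: leq_sum => y _; rewrite muln1; apply: sum_fresh_le2.
by rewrite sm; lia.
Qed.

Lemma window_pair_mean t m : 0 <= h ->
  \sum_(l < 2 * m) wmean (2 * (2 * m))
     (fun s => (window t m (seg 0 (2 * m) s))%:R * (window t m (seg l (2 * m) s))%:R)
   <= 2 * (size F)%:R * h ^+ t
      + (2 * m)%:R * (2 * m).+1%:R ^+ #|D| * (h + eta) ^+ (2 * t) :> R.
Proof.
move=> h0; rewrite -wmean_sum.
pose G s : R := 2 * (size F)%:R * (t <= ret (seg m m s))%N%:R +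
  \sum_(l < 2 * m) \sum_(c : {ffun D -> 'I_(2 * m).+1} | encode c \notin F)
        (2 * t <= vis (pair0 (encode c)) 0%R (drop m s))%N%:R.
apply: (@le_trans _ _ (wmean (2 * (2 * m)) G)).
  apply: wmean_le => s sm; have := @window_pair_pointwise t m s; rewrite sm.
  rewrite mulnA => /(_ erefl); rewrite -(ler_nat R) natr_sum natrD !natrM !natr_sum.
  move=> /le_trans H; apply: le_trans (H _ _); last first.
    by rewrite /G lerD //; apply: ler_sum => l _; rewrite natr_sum.
  by apply: ler_sum => l _; rewrite natrM.
rewrite wmeanD wmeanZ lerD //.
  rewrite ler_wpM2l ?mulr_ge0 // (wmean_seg D0 (fun s => (t <= ret s)%N%:R)); last by lia.
  exact: wprob_ret_geom.
rewrite wmean_sum -mulrA mulr_natl -[in leRHS](card_ord (2 * m)) -sumr_const.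
apply: ler_sum => l _; rewrite wmean_sum.
apply: (@le_trans _ _ (\sum_(c : {ffun D -> 'I_(2 * m).+1}) (h + eta) ^+ (2 * t))).
  rewrite [leRHS](bigID (fun c => encode c \notin F)) /= -[leLHS]addr0 lerD //.
    apply: ler_sum => c cF; rewrite (wmean_drop D0 (fun s => (2 * t <= vis (pair0 (encode c)) 0 s)%N%:R)).
      exact: wprob_two_points.
    by lia.
  by apply: sumr_ge0 => c _; rewrite exprn_ge0 // addr_ge0.
by rewrite sumr_const card_ffun !card_ord -natrX mulr_natl.
Qed.

End PairBound.

Section Sandwich.

(* Here s consists of the second and later steps of the walk: local times do not
   count time 0, so the first position that matters is S_1. *)
Definition new i s : bool := ret (rev (take i s)) == 0%N.

(** The first visit comes on top of the [t] returns, hence [t + 1] visits. The length of [s] is a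
    horizon separate from [n]: the shortest one gives [R(t+1, n)], a long one [V(t+1, n)]. *)
Definition visited_count t n s : nat := (\sum_(i < n) (new i s && (t <= ret (drop i s))))%N.

(** This count and the next two hold the discrepancies between windows and points: a window at a
    point seen more than [m] steps ago, a point visited too early to have a window, a point whose
    returns come too late for its window. *)
Definition stale_count t m n s : nat :=
  (\sum_(j < n) [&& ret (rev (seg j m s)) == 0, ~~ new (j + m) s & t <= ret (seg (j + m) m s)])%N.

Definition early_count t m s : nat := (\sum_(i < m) (t <= ret (drop i s)))%N.

Definition late_count t m n s : nat :=
  (\sum_(j < n) ((ret (seg (m + j) m s) < t) && (t <= ret (drop (m + j) s))))%N.

Lemma sum_nat_shift m n (b : nat -> nat) :
  (\sum_(m <= i < m + n) b i = \sum_(j < n) b (m + j))%N.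
Proof.
by rewrite -{1}[m]add0n big_addn addKn big_mkord; apply: eq_bigr => i _; rewrite addnC.
Qed.

Lemma window_count_le t m n s : (n + m <= (size s).+1)%N ->
  (window_count t m n s <= visited_count t (size s).+1 s + stale_count t m n s)%N.
Proof.
move=> nm; pose b i : nat := new i s && (t <= ret (drop i s))%N.
apply: (@leq_trans (\sum_(j < n) b (m + j)%N + stale_count t m n s)).
  rewrite /stale_count -big_split; apply: leq_sum => j _ /=.
  rewrite window_seg /b [(m + j)%N]addnC.
  have [_|] //= := boolP (ret (rev (seg j m s)) == 0)%N.
  have [t1|] //= := leqP t (ret (seg (j + m) m s)).
  have -> : (t <= ret (drop (j + m) s))%N by apply: leq_trans t1 _; apply: vis_take.
  by case: (new _ _).
rewrite leq_add2r /visited_count -(big_mkord xpredT (fun i => b i)).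
rewrite (big_cat_nat (leq0n m)) /=; last by lia.
apply: leq_trans (leq_addl _ _).
rewrite (@big_cat_nat _ _ _ (m + n)) /=; [|lia|lia].
apply: leq_trans (leq_addr _ _).
by rewrite sum_nat_shift.
Qed.

Lemma visited_count_le t m n s : (n + 2 * m <= size s)%N ->
  (visited_count t n s
    <= window_count t m n s + early_count t m s + late_count t m n s)%N.
Proof.
move=> nm; pose b i : nat := new i s && (t <= ret (drop i s))%N.
apply: (@leq_trans (\sum_(i < m) b i + \sum_(j < n) b (m + j)))%N.
  rewrite /visited_count -(big_mkord xpredT (fun i => b i)).
  rewrite -(big_mkord xpredT (fun i => b i)) -sum_nat_shift -big_cat_nat ?leq_addr //=.
  by rewrite [leqRHS](@big_cat_nat _ _ _ n 0 (m + n)) ?leq_addl //= leq_addr.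
rewrite addnAC addnC leq_add //.
  rewrite /window_count /late_count -big_split; apply: leq_sum => j _ /=.
  rewrite window_seg /b; have [nw|] //= := boolP (new _ _).
  have -> : ret (rev (seg j m s)) == 0%N.
    rewrite -leqn0; move: nw; rewrite /new => /eqP <-.
    by rewrite addnC takeD rev_cat /ret vis_cat leq_addr.
  by rewrite addnC; case: leqP; case: (t <= ret (drop _ _))%N.
by apply: leq_sum => i _; rewrite /b; case: (new _ _).
Qed.

End Sandwich.

End Window.

(** * Tail bounds for the number of much visited points at one scale *)

Section TailBounds.
Variables (R : rcfType) (D : finType) (V : zmodType) (st : D -> V).
Hypothesis D0 : (0 < #|D|)%N.
Local Notation ret := (ret st).
Local Notation retp := (retp st R).
Implicit Types (s u v : seq D) (t m n : nat).

Variables (h eta : R) (F : seq V).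
Hypothesis h_ge : forall n, retp n <= h.
Hypothesis h_gt0 : 0 < h.
Hypothesis h_lt1 : h < 1.
Hypothesis eta0 : 0 <= eta.
Hypothesis F0 : 0 \in F.
Hypothesis F_far : forall x n, x \notin F ->
  hit st R (pred1 x) 0 n <= eta /\ hit st R (pred1 (- x)) 0 n <= eta.

Lemma wprob_fresh n : wprob n (fun s => ret (rev s) == 0)%N = 1 - retp n.
Proof.
rewrite /wprob (wmean_rev n (fun u => (ret u == 0)%N%:R)) retpE.
rewrite -[X in X - _](wmean_cst D0 n 1) -wmeanB.
apply: eq_wmean => s _; rewrite lt0n.
by case: (_ == _); rewrite /= ?subr0 ?subrr.
Qed.

(** By reversal, a point fresh for [m] steps but not new means a first return after time [m], of
    probability at most [h - retp m]; the later returns are independent of it. *)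
Lemma wmean_stale_count t m n L : (n + 2 * m <= L)%N ->
  wmean L (fun s => (stale_count st t m n s)%:R) <= n%:R * (h - retp m) * h ^+ t.
Proof.
move=> nL; rewrite -mulrA mulr_natl -[in leRHS](card_ord n) -sumr_const.
under eq_wmean do rewrite natr_sum.
rewrite wmean_sum; apply: ler_sum => j _; have jn := ltn_ord j.
pose A u : R := (ret (rev (drop j u)) == 0)%N%:R - (ret (rev u) == 0)%N%:R.
pose F2 u v : R := A u * (t <= ret (take m v))%N%:R.
apply: (@le_trans _ _ (wmean L (fun s => F2 (take (j + m) s) (drop (j + m) s)))).
  apply: wmean_le => s sL; rewrite /F2 /A /new.
  rewrite (_ : drop j (take (j + m) s) = seg j m s); last by rewrite /seg take_drop addnC.
  have : (ret (rev (seg j m s)) <= ret (rev (take (j + m) s)))%N.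
    by rewrite takeD rev_cat /ret vis_cat leq_addr.
  case: (ret (rev (seg j m s))) => [|k]; case: (ret (rev (take _ s))) => [|k'] //= _;
    rewrite ?subr0 ?subrr ?mul1r ?mul0r //.
rewrite (wmean_split F2); last by lia.
under eq_wmean do rewrite wmeanZ mulrC.
rewrite wmeanZ mulrC.
have -> : wmean (j + m) A = retp (j + m) - retp m.
  rewrite wmeanB (wmean_drop D0 (fun u => (ret (rev u) == 0)%N%:R)) ?leq_addr // addKn.
  rewrite -/(wprob m (fun u => ret (rev u) == 0)%N) -/(wprob (j + m) (fun u => ret (rev u) == 0)%N).
  by rewrite !wprob_fresh; ring.
rewrite (wmean_take D0 (fun u => (t <= ret u)%N%:R)); last by lia.
apply: ler_pM.
- by rewrite subr_ge0 retp_mono // leq_addl.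
- exact: wprob_ge0.
- by rewrite lerD2r h_ge.
- exact: wprob_ret_geom.
Qed.

Lemma wmean_early_count t m L : (m <= L)%N ->
  wmean L (fun s => (early_count st t m s)%:R) <= m%:R * h ^+ t.
Proof.
move=> mL; rewrite mulr_natl -[in leRHS](card_ord m) -sumr_const.
under eq_wmean do rewrite natr_sum.
rewrite wmean_sum; apply: ler_sum => j _; have jm := ltn_ord j.
rewrite (wmean_drop D0 (fun u => (t <= ret u)%N%:R)); last by lia.
exact: wprob_ret_geom.
Qed.

Lemma wmean_late_count t m n L : (n + 2 * m <= L)%N ->
  wmean L (fun s => (late_count st t m n s)%:R)
    <= n%:R * (h ^+ t - wprob m (fun s => t <= ret s)%N).
Proof.
move=> mL; rewrite mulr_natl -[in leRHS](card_ord n) -sumr_const.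
under eq_wmean do rewrite natr_sum.
rewrite wmean_sum; apply: ler_sum => j _; have jn := ltn_ord j.
pose G u : R := (t <= ret u)%N%:R - (t <= ret (take m u))%N%:R.
rewrite (@eq_wmean _ _ _ _ (fun s => G (drop (m + j) s))); last first.
  move=> s _; rewrite /G /seg; have := vis_take st (pred1 0) 0 m (drop (m + j) s).
  rewrite -!/(ret _) => tk; case: leqP => t1; case: leqP => t2 //=; rewrite ?subr0 ?subrr //.
  by move: (leq_trans t1 tk); rewrite leqNgt t2.
rewrite (wmean_drop D0 G) ?wmeanB; last by lia.
rewrite lerB ?wprob_ret_geom //.
by rewrite (wmean_take D0 (fun u => (t <= ret u)%N%:R)); last by lia.
Qed.

Definition pair_bound t m : R :=
  2 * (size F)%:R * h ^+ t + (2 * m)%:R * (2 * m).+1%:R ^+ #|D| * (h + eta) ^+ (2 * t).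

Lemma window_count_deviation t m n L (c : R) : (n + 2 * m <= L)%N -> 0 < c ->
  wprob L (fun s => c <= `|(window_count st t m n s)%:R - n%:R * window_mean R st t m|)
    <= 2 * n%:R * pair_bound t m / c ^+ 2.
Proof.
move=> nL c0; apply: le_trans (chebyshev_wprob _ _ _ c0) _.
rewrite ler_wpM2r ?invr_ge0 ?sqr_ge0 //.
pose f s : R := (window st t m s)%:R.
rewrite (@eq_wmean _ _ _ _ (fun s => (\sum_(j < n) f (seg j (2 * m) (take (n + 2 * m) s))
    - n%:R * wmean (2 * m) f) ^+ 2)); last first.
  move=> s _; rewrite /window_count natr_sum; congr ((_ - _) ^+ 2).
  by apply: eq_bigr => j _; rewrite seg_take // leq_add2r ltnW.
rewrite (wmean_take D0 (fun s => (\sum_(j < n) f (seg j (2 * m) s) - n%:R * wmean (2 * m) f) ^+ 2)) //.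
apply: le_trans (block_variance D0 (2 * m) n _) _; first by move=> s; rewrite ler0n.
rewrite ler_wpM2l ?mulr_ge0 //.
by apply: window_pair_mean => //; apply: ltW.
Qed.

Section Params.
Variables (t m N : nat) (e delta theta : R).
Hypothesis e01 : 0 < e <= 1.
Hypothesis N0 : (0 < N)%N.
Hypothesis deltaP : h - delta <= retp m.
Hypothesis delta_small : delta <= (1 - h) * e / 4.
Hypothesis thetaP : h ^+ t * (1 - theta) <= wprob m (fun s => t <= ret s)%N.
Hypothesis theta_small : theta <= e / 8.
Hypothesis mN : (2 * m).+1%:R <= e / 8 * N%:R.

(** The target mean. The relative error [e] is spent as [e/4] on the bias of the window mean, [e/4]
    on its fluctuation and [e/2] on the miscounted points. *)
Let a := N%:R * (1 - h) * h ^+ t.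

Let a0 : 0 < a.
Proof. by rewrite !mulr_gt0 ?exprn_gt0 ?ltr0n ?subr_gt0. Qed.

Let ht0 : 0 < h ^+ t. Proof. by rewrite exprn_gt0. Qed.

Let e0 : 0 < e. Proof. by case/andP: e01. Qed.
Let e1 : e <= 1. Proof. by case/andP: e01. Qed.
Let g0 : 0 < 1 - h. Proof. by rewrite subr_gt0. Qed.
Let N0R : 0 < N%:R :> R. Proof. by rewrite ltr0n. Qed.

Let e2a : 0 < e / 2 * a.
Proof. by rewrite mulr_gt0 // divr_gt0. Qed.

Let e4a : 0 < e / 4 * a.
Proof. by rewrite mulr_gt0 // divr_gt0. Qed.

Let C0 : 0 <= 2 / (e * (1 - h)).
Proof. by rewrite divr_ge0 // mulr_ge0 // ltW. Qed.

Let wm_le : window_mean R st t m <= (1 - h + delta) * h ^+ t.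
Proof.
rewrite window_meanE //; apply: ler_pM.
- by rewrite subr_ge0; apply: le_trans (h_ge m) (ltW h_lt1).
- exact: wprob_ge0.
- by move: deltaP; lra.
- exact: wprob_ret_geom.
Qed.

Let wm_ge : (1 - h) * (h ^+ t * (1 - theta)) <= window_mean R st t m.
Proof.
rewrite window_meanE //; apply: ler_pM => //.
- exact: ltW.
- by rewrite mulr_ge0 ?ltW //; move: theta_small e1; lra.
- by rewrite lerD2l lerN2.
Qed.

(** In order: Chebyshev for pairs with difference in [F], Chebyshev for the other pairs, Markov for
    the miscounted points. The factor 64 is [2 * 2 * 16], with 16 from the deviation [e a / 4]. *)
Definition tail_bound : R :=
  64 * (size F)%:R / (e * (1 - h)) ^+ 2 / (N%:R * h ^+ t)
  + 64 / (e * (1 - h)) ^+ 2 * (m%:R * (2 * m).+1%:R ^+ #|D|)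
     * ((h + eta) ^+ (2 * t) / (N%:R * h ^+ (2 * t)))
  + 2 / (e * (1 - h)) * (m%:R / N%:R + theta + delta).

Lemma deviation_tail n : (n <= N)%N ->
  2 * n%:R * pair_bound t m / (e / 4 * a) ^+ 2 <=
  64 * (size F)%:R / (e * (1 - h)) ^+ 2 / (N%:R * h ^+ t)
  + 64 / (e * (1 - h)) ^+ 2 * (m%:R * (2 * m).+1%:R ^+ #|D|)
     * ((h + eta) ^+ (2 * t) / (N%:R * h ^+ (2 * t))).
Proof.
move=> nN; have pb0 : 0 <= pair_bound t m.
  have hh0 := ltW h_gt0; by rewrite /pair_bound !(addr_ge0, mulr_ge0, exprn_ge0).
apply: (@le_trans _ _ (2 * N%:R * pair_bound t m / (e / 4 * a) ^+ 2)).
  by rewrite !ler_wpM2r ?invr_ge0 ?sqr_ge0 // ler_wpM2l // ler_nat.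
rewrite le_eqVlt; apply/orP; left; apply/eqP.
rewrite /pair_bound /a natrM (mulnC 2 t) exprM.
move: (gt_eqF e0) (gt_eqF g0) (gt_eqF N0R) (gt_eqF ht0).
rewrite !exprM; set x := h ^+ t; set y := (h + eta) ^+ t; set z := _ ^+ #|D|.
move=> en gn Nn xn; field.
by rewrite xn Nn gn en.
Qed.

Let err_tail (x y : R) : 0 <= y -> 0 <= x -> y <= x * a / (1 - h) -> y / (e / 2 * a) <= 2 / (e * (1 - h)) * x.
Proof.
move=> y0 x0 yx; rewrite ler_pdivrMr //.
apply: le_trans yx _; rewrite le_eqVlt; apply/orP; left; apply/eqP.
field; by rewrite !gt_eqF.
Qed.

Let delta0 : 0 <= delta.
Proof. by move: deltaP (h_ge m); lra. Qed.

Let theta0 : 0 <= theta.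
Proof.
have := le_trans thetaP (wprob_ret_geom D0 m t h_ge).
by rewrite -[leRHS]mulr1 ler_pM2l // gerBl.
Qed.

Lemma lower_tail L : L.+1 = N ->
  wprob L (fun s => (visited_count st t N s)%:R < (1 - e) * a) <= tail_bound.
Proof.
move=> LN; have m2 : (2 * m <= L)%N.
  have : (2 * m).+1%:R <= N%:R :> R.
    by apply: le_trans mN _; rewrite ler_piMl ?ltW //; move: e1; lra.
  by rewrite ler_nat -LN ltnS.
(* Complete windows exist for all but [2m + 1] of the [N] starting times; by [mN] this loss is at
   most a relative [e/8]. *)
pose n := (L - 2 * m)%N; have nL : (n + 2 * m <= L)%N by rewrite /n subnK.
have nN : n%:R = N%:R - (2 * m).+1%:R :> R by rewrite -natrB; [congr _%:R|]; rewrite /n -LN ?subSS // ltnS.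
apply: (@le_trans _ _ (wprob L (fun s => (e / 4 * a
    <= `|(window_count st t m n s)%:R - n%:R * window_mean R st t m|)
   || (e / 2 * a <= (stale_count st t m n s)%:R)))).
  apply: wprob_le => s sL; apply: contraTT; rewrite negb_or -!ltNge -leNgt.
  move=> /andP[w1 w2].
  have W : (window_count st t m n s <= visited_count st t N s + stale_count st t m n s)%N.
    rewrite -LN -sL window_count_le // sL; clear -nL; lia.
  rewrite -(ler_nat R) natrD in W.
  have nw : a * (1 - e / 4) <= n%:R * window_mean R st t m.
    have N1 : N%:R * (1 - e / 8) <= n%:R by rewrite nN; move: mN; lra.
    apply: (@le_trans _ _ ((N%:R * (1 - e / 8)) * ((1 - h) * (h ^+ t * (1 - theta))))).
      rewrite /a; have -> : N%:R * (1 - e / 8) * ((1 - h) * (h ^+ t * (1 - theta)))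
        = a * ((1 - e / 8) * (1 - theta)) by rewrite /a; ring.
      rewrite ler_wpM2l ?ltW //; move: theta_small e0 e1 theta0; nra.
    apply: ler_pM => //.
      by rewrite mulr_ge0 ?ltW //; move: e1; lra.
    by rewrite !mulr_ge0 ?ltW //; move: theta_small e1; lra.
  move: w1; rewrite ltr_distlC => /andP[_ w1]; lra.
apply: le_trans (wprobU _ _ _ _) _; apply: lerD.
  apply: le_trans (@window_count_deviation t m n L _ nL e4a) _.
  by apply: deviation_tail; rewrite /n -LN; clear; lia.
apply: le_trans (markov_wprob _ _) _ => //.
apply: (@le_trans _ _ (2 / (e * (1 - h)) * delta)); last first.
  by rewrite ler_wpM2l // lerDr addr_ge0 // divr_ge0.
apply: err_tail => //; first by apply: wmean_ge0 => // s _; rewrite ler0n.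
apply: le_trans (wmean_stale_count _ nL) _.
have -> : delta * a / (1 - h) = N%:R * delta * h ^+ t by rewrite /a; field; rewrite gt_eqF.
rewrite ler_pM2r // ler_pM ?subr_ge0 //; last by move: deltaP; lra.
by rewrite ler_nat /n -LN; clear; lia.
Qed.

(** The bound does not involve [L], so it survives the passage to an infinite horizon that total
    local times require. *)
Lemma upper_tail L : (N + 2 * m <= L)%N ->
  wprob L (fun s => (1 + e) * a < (visited_count st t N s)%:R) <= tail_bound.
Proof.
move=> NL.
apply: (@le_trans _ _ (wprob L (fun s => (e / 4 * a
    <= `|(window_count st t m N s)%:R - N%:R * window_mean R st t m|)
   || (e / 2 * a <= (early_count st t m s)%:R + (late_count st t m N s)%:R)))).
  apply: wprob_le => s sL; apply: contraTT; rewrite negb_or -!ltNge -leNgt.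
  move=> /andP[w1 w2].
  have W := @visited_count_le D V st D0 t m N s; rewrite sL in W; move: (W NL) => {}W.
  rewrite -(ler_nat R) !natrD in W.
  have nw : N%:R * window_mean R st t m <= a * (1 + e / 4).
    apply: (@le_trans _ _ (N%:R * ((1 - h + delta) * h ^+ t))).
      by rewrite ler_wpM2l // ltW.
    rewrite /a; have -> : N%:R * ((1 - h + delta) * h ^+ t)
        = N%:R * h ^+ t * (1 - h + delta) by ring.
    rewrite (_ : _ * (1 + e / 4) = N%:R * h ^+ t * ((1 - h) * (1 + e / 4))); last by ring.
    by rewrite ler_pM2l ?mulr_gt0 //; move: delta_small; lra.
  move: w1; rewrite ltr_distlC => /andP[w1 _]; lra.
apply: le_trans (wprobU _ _ _ _) _; apply: lerD.
  exact: le_trans (@window_count_deviation t m N L _ NL e4a) (deviation_tail (leqnn N)).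
have err0 s : size s = L -> 0 <= (early_count st t m s)%:R + (late_count st t m N s)%:R :> R.
  by move=> _; rewrite addr_ge0.
apply: le_trans (markov_wprob e2a err0) _.
apply: (@le_trans _ _ (2 / (e * (1 - h)) * (m%:R / N%:R + theta))); last first.
  by rewrite ler_wpM2l // lerDl.
apply: err_tail => //; first by apply: wmean_ge0 => // s _; rewrite addr_ge0.
  by rewrite addr_ge0 ?divr_ge0.
rewrite wmeanD; apply: le_trans (lerD (wmean_early_count _ _) (wmean_late_count _ NL)) _.
  by clear -NL; lia.
have -> : (m%:R / N%:R + theta) * a / (1 - h) = m%:R * h ^+ t + N%:R * (h ^+ t * theta).
  by rewrite /a; field; rewrite !gt_eqF.
rewrite lerD2l ler_wpM2l //; move: thetaP; lra.
Qed.

End Params.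
End TailBounds.

(** * Elementary growth estimates *)

Section Growth.
Variable R : realType.

Lemma nat_ge_eventually (x : R) : exists k0, forall k, (k0 <= k)%N -> x <= k%:R.
Proof.
exists (Num.truncn x).+1 => k k0k; apply: ltW; apply: lt_le_trans (truncnS_gt x) _.
by rewrite ler_nat.
Qed.

Lemma bernoulli_ge (x : R) t : 0 <= x <= 1 -> 1 - t%:R * x <= (1 - x) ^+ t.
Proof.
move=> /andP[x0 x1]; elim: t => [|t IHt]; first by rewrite mul0r subr0 expr0.
rewrite exprS; apply: (@le_trans _ _ ((1 - x) * (1 - t%:R * x))).
  rewrite -natr1; have : 0 <= t%:R * (x * x) :> R by rewrite !mulr_ge0.
  by nra.
by rewrite ler_wpM2l // subr_ge0.
Qed.

Lemma linear_le_exp (r : R) : 1 < r -> exists2 C : R, 0 < C & forall k, k%:R <= C * r ^+ k.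
Proof.
move=> r1; exists ((r - 1)^-1) => [|k]; first by rewrite invr_gt0 subr_gt0.
rewrite mulrC ler_pdivlMr ?subr_gt0 //.
elim: k => [|k IHk]; first by rewrite mul0r expr0.
rewrite exprS -natr1; have : 1 <= r ^+ k by rewrite exprn_ege1 // ltW.
by nra.
Qed.

(** One factor [sqrt r ^ k] pays for one factor [k], the other for the remaining [p]. *)
Lemma pow_le_exp p (r : R) : 1 < r ->
  exists2 C : R, 0 < C & forall k, k%:R ^+ p <= C * r ^+ k.
Proof.
elim: p r => [|p IHp] r r1.
  by exists 1 => // k; rewrite expr0 mul1r exprn_ege1 // ltW.
have r0 : 0 < r by apply: lt_trans r1.
have s1 : 1 < Num.sqrt r by rewrite -sqrtr1 ltr_sqrt.
have [C1 C10 H1] := linear_le_exp s1; have [C2 C20 H2] := IHp _ s1.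
exists (C1 * C2) => [|k]; first exact: mulr_gt0.
have kp : 0 <= k%:R ^+ p :> R by apply: exprn_ge0.
rewrite exprS; apply: le_trans (ler_pM _ kp (H1 k) (H2 k)) _ => //.
by rewrite mulrACA -exprMn -expr2 sqr_sqrtr // ltW.
Qed.

Lemma isqrt_le m n : (0 < m <= n)%N -> isqrt R n <= isqrt R m.
Proof.
move=> /andP[m0 mn]; rewrite lef_pV2 ?posrE ?sqrtr_gt0 ?ltr0n //; last exact: leq_trans mn.
by rewrite ler_sqrt ?ltr0n // ?ler_nat // (leq_trans m0).
Qed.

Lemma isqrt_small (K e : R) : 0 <= K -> 0 < e ->
  exists n0, forall n, (n0 <= n)%N -> K * isqrt R n.+1 <= e.
Proof.
move=> K0 e0; have [n0 H] := nat_ge_eventually ((K / e) ^+ 2).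
exists n0 => n /H {}H; rewrite /isqrt ler_pdivrMr ?sqrtr_gt0 ?ltr0n //.
rewrite -ler_pdivrMl // mulrC -(@ler_pXn2r _ 2) ?nnegrE ?sqrtr_ge0 ?divr_ge0 ?(ltW e0) //.
rewrite sqr_sqrtr //; apply: le_trans H _.
by rewrite ler_nat.
Qed.

(* The admissible terms form a geometric progression with last term at most c. *)
Lemma sum_inv_geom_le (h c : R) (a : nat -> R) n : 0 < h < 1 -> 0 <= c ->
  (forall t, 0 < a t) -> (forall t, a t = h * a t.+1) ->
  \sum_(t < n | a t <= c) a t <= c / (1 - h).
Proof.
move=> /andP[h0 h1] c0 a0 aS; have g0 : 0 < 1 - h by rewrite subr_gt0.
have full k : \sum_(t < k.+1) a t <= a k / (1 - h).
  elim: k => [|k IHk].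
    by rewrite big_ord_recr big_ord0 /= add0r ler_peMr ?(ltW (a0 _)) // invf_ge1 //; lra.
  rewrite big_ord_recr /=; apply: le_trans (lerD IHk (lexx _)) _.
  rewrite (aS k) -subr_ge0 le_eqVlt; apply/orP; left; apply/eqP.
  by field; rewrite gt_eqF.
elim: n => [|n IHn]; first by rewrite big_ord0 divr_ge0 // ltW.
rewrite big_mkcond big_ord_recr /= -big_mkcond /=.
case: ifP => [an|_]; last by rewrite addr0.
apply: (@le_trans _ _ (\sum_(t < n.+1) a t)); last first.
  by apply: le_trans (full n) _; rewrite ler_wpM2r ?invr_ge0 ?(ltW g0).
rewrite big_ord_recr /= lerD2r [leRHS](bigID (fun t : 'I_n => a t <= c)) /= lerDl.
by apply: sumr_ge0 => t _; apply: ltW.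
Qed.

End Growth.

(** * Choice of the parameters and summable tails along a geometric scale *)

Section Tails.
Variables (R : realType) (D : finType) (V : zmodType) (st : D -> V).
Hypothesis D0 : (0 < #|D|)%N.
Local Notation ret := (ret st).
Local Notation retp := (retp st R).
Variable K : R.
Hypothesis K0 : 0 <= K.
Hypothesis local : forall k x,
  wprob k.+1 (fun s => pos st s == x) <= K * (isqrt R k.+1 - isqrt R k.+2).
Variable h : R.
Hypothesis h_ge : forall n, retp n <= h.
Hypothesis h_tail : forall m, h <= retp m + K * isqrt R m.+1.
Hypothesis h0 : 0 < h.

(* If h were 1, the expected number of returns would be unbounded. *)
Lemma return_prob_lt1 : h < 1.
Proof.
rewrite ltNge; apply/negP => h1.
(* With [retp l >= 1 - 1/(2k)], Bernoulli's inequality gives [retp l ^+ k >= 1/2], hence [k/2 <= K],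
   against [k >= 2K + 1]. *)
have [k0 kP] := nat_ge_eventually (2 * K + 1); set k := k0.+1.
have k1 : 0 < (2 * k%:R)^-1 :> R by rewrite invr_gt0 mulr_gt0 ?ltr0n.
have [l lP] := isqrt_small K0 k1; have {lP} := lP l (leqnn _).
set x := (2 * k%:R)^-1 => xP.
have kx : k%:R * x = 2^-1 by rewrite /x; field; rewrite pnatr_eq0.
have x1 : 0 <= x <= 1.
  rewrite ltW //= /x invf_le1 ?mulr_gt0 ?ltr0n //.
  by have : 1 <= k%:R :> R by [rewrite ler1n]; lra.
have := mul_retp_exp_le D0 K0 local k l.
have : (1 - x) ^+ k <= retp l ^+ k.
  rewrite lerXn2r ?nnegrE ?wprob_ge0 //.
    by rewrite subr_ge0; case/andP: x1.
  by have := h_tail l; lra.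
have := bernoulli_ge k x1; rewrite kx; have := kP k (leqnSn _).
have : 0 <= k%:R :> R by [].
by nra.
Qed.

(** The inequality on powers bounds [(h + eta)^(2t) / h^(2t)] by [h^(-t/2)], at most [N^(1/2)] as
    soon as [N h^t >= 1]: divided by [N], it decays like [N^(-1/2)]. *)
Lemma exists_near_set : exists eta (F : seq V),
  [/\ 0 <= eta, 0 \in F, (h + eta) ^+ 4 <= h ^+ 3 & forall x n, x \notin F ->
    hit st R (pred1 x) 0 n <= eta /\ hit st R (pred1 (- x)) 0 n <= eta].
Proof.
have h1 := return_prob_lt1.
(* Expanding [(h + eta)^4] leaves [h^4 + eta (4 + 6 + 4 + 1)] at most, which the constant 15 makes
   equal to [h^3]. *)
pose eta := h ^+ 3 * (1 - h) / 15.
have eta0 : 0 < eta by rewrite divr_gt0 ?mulr_gt0 ?exprn_gt0 ?subr_gt0.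
have [r rP] := isqrt_small K0 eta0; have {}rP := rP r (leqnn _).
exists eta, (reach st r ++ [seq - x | x <- reach st r]); split.
- exact: ltW.
- by rewrite mem_cat; case: r {rP} => [|r] /=; rewrite inE eqxx.
- have e1 : eta <= 1.
    have h3 : h ^+ 3 <= 1 by rewrite exprn_ile1 ?ltW.
    have h30 : 0 <= h ^+ 3 by rewrite exprn_ge0 ?ltW.
    by rewrite ler_pdivrMr // mul1r; move: h0 h1; nra.
  have : 15 * eta = h ^+ 3 * (1 - h) by rewrite /eta; field.
  move: eta eta0 e1 {rP} => z z0 z1 zE.
  have -> : (h + z) ^+ 4 = h ^+ 4 + z * (4 * h ^+ 3 + 6 * h ^+ 2 * z + 4 * h * z ^+ 2 + z ^+ 3).
    by ring.
  have -> : h ^+ 3 = h ^+ 4 + z * 15 by rewrite [z * _]mulrC zE; ring.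
  rewrite lerD2l ler_pM2l //.
  have h3 : h ^+ 3 <= 1 by rewrite exprn_ile1 ?ltW.
  have z3 : z ^+ 3 <= 1 by rewrite exprn_ile1 ?(ltW z0).
  have hz : h ^+ 2 * z <= 1.
    by rewrite mulr_ile1 ?exprn_ile1 ?exprn_ge0 ?(ltW z0) ?(ltW h0) ?(ltW h1).
  have hz2 : h * z ^+ 2 <= 1.
    by rewrite mulr_ile1 ?exprn_ile1 ?exprn_ge0 ?(ltW z0) ?(ltW h0) ?(ltW h1).
  by lra.
- move=> x n; rewrite mem_cat negb_or => /andP[x1 x2].
  have x3 : - x \notin reach st r.
    by apply: contra x2 => x2; apply/mapP; exists (- x); rewrite ?opprK.
  by split; apply: le_trans rP; apply: hit_far.
Qed.

Definition scale (rho : R) k : nat := (Num.truncn (rho ^+ k)).+1.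

Lemma scale_gt rho k : rho ^+ k < (scale rho k)%:R.
Proof. exact: truncnS_gt. Qed.

Lemma scale_le rho k : 0 <= rho -> (scale rho k)%:R <= rho ^+ k + 1.
Proof. by move=> r0; rewrite -natr1 lerD2r truncn_le exprn_ge0. Qed.

(** Only [O(k)] values of [t] are admissible at scale [k]: once [h^A rho <= 1], taking [t >= A k]
    would make the right side at most 2. This limits both the union over [t] and the window
    length. *)
Lemma range_of_t (rho : R) : 1 < rho -> exists2 A, (0 < A)%N & forall k t, (1 < k)%N ->
  k%:R ^+ 2 <= (scale rho k)%:R * h ^+ t -> (t < A * k)%N.
Proof.
move=> r1; have h1 := return_prob_lt1.
have r0 : 0 < rho by apply: lt_trans r1.
have hV : 1 < h^-1 by rewrite invf_gt1.
have [C C0 CP] := linear_le_exp hV.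
have [a aP] := nat_ge_eventually (C * rho); exists a.+1 => // k t k1.
have hA : h ^+ a.+1 * rho <= 1.
  have := CP a.+1; have := aP a.+1 (leqnSn _); rewrite exprVn => H1 H2.
  have ha : 0 < h ^+ a.+1 by rewrite exprn_gt0.
  have : C * rho <= C / h ^+ a.+1 by apply: le_trans H2.
  by rewrite ler_pM2l // -[_^-1]div1r ler_pdivlMr // mulrC.
apply: contraTT; rewrite -leqNgt -ltNge => ta.
apply: (@le_lt_trans _ _ 2%:R); last first.
  by rewrite -natrX ltr_nat; nia.
apply: (@le_trans _ _ ((rho ^+ k + 1) * (h ^+ (a.+1 * k)))).
  apply: ler_pM => //; first by rewrite exprn_ge0 // ltW.
    exact/scale_le/ltW.
  by rewrite ler_wiXn2l ?ltW.
rewrite mulrDl mul1r exprM -exprMn (_ : 2%:R = 1 + 1) // lerD //.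
  by rewrite mulrC exprn_ile1 // mulr_ge0 ?exprn_ge0 // ltW.
by rewrite -exprM exprn_ile1 ?ltW.
Qed.

(** The first term of [b] is summed over [t] as a geometric progression. The second is repeated for
    [O(k)] values of [t], so its exponent 3 leaves [k^(-2)]. The upper estimate holds for all long
    horizons, with [b] free of the horizon. *)
Lemma tails_summable (rho e : R) : 1 < rho -> 0 < e <= 1 ->
  exists (C : R) (k0 A : nat), 0 <= C /\ forall k t, (k0 <= k)%N ->
   let N := scale rho k in k%:R ^+ 2 <= N%:R * h ^+ t ->
   let a := N%:R * (1 - h) * h ^+ t in
   let b := C / (N%:R * h ^+ t) + C / k%:R ^+ 3 in
   [/\ (t < A * k)%N,
    forall L, L.+1 = N -> wprob L (fun s => (visited_count st t N s)%:R < (1 - e) * a) <= b &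
    exists H, forall L, (H <= L)%N ->
      wprob L (fun s => (1 + e) * a < (visited_count st t N s)%:R) <= b].
Proof.
move=> r1 e01; have h1 := return_prob_lt1; have g0 : 0 < 1 - h by rewrite subr_gt0.
have r0 : 0 < rho by apply: lt_trans r1.
have [/andP[e0 e1]] := (e01, e01) => _.
have [eta [F [eta0 F0 hF Ffar]]] := exists_near_set.
have [A A0 AP] := range_of_t r1.
(* As [m] will be [A k^9], the prefactor [m (2m + 1)^q] times [k^3] has degree [p] in [k]. Likewise
   the 12 below is [9 + 3], for [m / N]. *)
set q := #|D|; pose p := (9 * q.+1 + 3)%N.
have [C1 C10 C1P] := pow_le_exp 12 r1.
have [C2 C20 C2P] := pow_le_exp (2 * p) r1.
pose c0 : R := 3 ^+ q * A%:R ^+ q.+1; pose M := c0 ^+ 2 * C2.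
have c00 : 0 <= c0 by rewrite mulr_ge0 ?exprn_ge0.
have M0 : 0 <= M by rewrite mulr_ge0 ?sqr_ge0 ?ltW.
have eg0 : 0 < e * (1 - h) by rewrite mulr_gt0.
pose B1 := 64 * (size F)%:R / (e * (1 - h)) ^+ 2.
pose B2 := 64 / (e * (1 - h)) ^+ 2 * (M + 1).
pose B3 := 2 / (e * (1 - h)) * (A%:R * C1 + A%:R * K / h + K).
have B10 : 0 <= B1 by apply: divr_ge0; [exact: mulr_ge0|exact: sqr_ge0].
have B20 : 0 <= B2 by rewrite /B2 mulr_ge0 ?addr_ge0 // divr_ge0 ?sqr_ge0.
have B30 : 0 <= B3.
  apply: mulr_ge0; first by apply: divr_ge0 => //; apply: ltW.
  by rewrite !addr_ge0 // ?divr_ge0 ?mulr_ge0 // ltW.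
(* The four thresholds serve, in order, Bernoulli's inequality, the smallness of [theta], that of
   [delta], and [mN]. *)
have [k1 k1P] := nat_ge_eventually (K / h).
have [k2 k2P] := nat_ge_eventually (A%:R * K / h / (e / 8)).
have [k3 k3P] := nat_ge_eventually (K / ((1 - h) * e / 4)).
have [k4 k4P] := nat_ge_eventually (3 * A%:R * C1 / (e / 8)).
exists (B1 + B2 + B3), (k1 + k2 + k3 + k4 + 2)%N, A; split; first by rewrite !addr_ge0.
move=> k t kk N kN a b; pose x : R := k%:R.
have [kk1 kk2 kk3 kk4 kgt1] : [/\ (k1 <= k)%N, (k2 <= k)%N, (k3 <= k)%N, (k4 <= k)%N & (1 < k)%N].
  by clear -kk; split; lia.
have k0 : (0 < k)%N by exact: ltnW.
have x1 : 1 <= x by rewrite ler1n.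
have x0 : 0 < x by apply: lt_le_trans x1.
have {}k1P : K / h <= x by apply: k1P.
have {}k2P : A%:R * K / h / (e / 8) <= x by apply: k2P.
have {}k3P : K / ((1 - h) * e / 4) <= x by apply: k3P.
have {}k4P : 3 * A%:R * C1 / (e / 8) <= x by apply: k4P.
have tA : (t < A * k)%N by apply: AP kN.
have N0 : (0 < N)%N by [].
have N0R : 0 < N%:R :> R by rewrite ltr0n.
have rN : rho ^+ k <= N%:R by apply/ltW/scale_gt.
have rk0 : 0 < rho ^+ k by rewrite exprn_gt0.
have ht0 : 0 < h ^+ t by rewrite exprn_gt0.
(* Each return gets [s0] steps and so misses a probability of at most [K / k^4]; [m] has room for
   [A k > t] returns in a row, with total relative loss [theta] of order [k^(-3)]. *)
pose s0 := ((k ^ 4) ^ 2)%N; pose m := (A * k * s0)%N.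
have s00 : (0 < s0)%N by rewrite !expn_gt0 k0.
have s0m : (s0 <= m)%N by rewrite leq_pmull // muln_gt0 A0.
have isq n : (s0 <= n)%N -> isqrt R n <= (x ^+ 4)^-1.
  move=> sn; apply: (@le_trans _ _ (isqrt R s0)); first by rewrite isqrt_le ?s00.
  by rewrite /isqrt /s0 natrX sqrtr_sqr ger0_norm // natrX.
have pw i j : (i <= j)%N -> x ^+ i <= x ^+ j by move=> ij; rewrite ler_weXn2l.
have px3 : x <= x ^+ 3 := pw 1%N 3%N isT.
have mE : m%:R = A%:R * x ^+ 9 :> R.
  have s0E : s0%:R = x ^+ 8 by rewrite /s0 !natrX -exprM.
  by rewrite /m natrM natrM s0E -mulrA -exprS.
pose delta := K / x ^+ 4; pose theta := t%:R * (K / x ^+ 4 / h).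
have deltaP j : (s0 <= j)%N -> h - delta <= retp j.
  move=> sj; rewrite lerBlDr; apply: le_trans (h_tail j) _; rewrite lerD2l.
  by rewrite /delta ler_wpM2l // isq // (leq_trans sj).
have xh : 0 <= K / x ^+ 4 / h <= 1.
  rewrite !divr_ge0 ?exprn_ge0 ?(ltW x0) ?(ltW h0) //= mulrAC ler_pdivrMr ?exprn_gt0 // mul1r.
  by apply: le_trans k1P _; apply: (pw 1%N).
have thetaP : h ^+ t * (1 - theta) <= wprob m (fun s => t <= ret s)%N.
  apply: (@le_trans _ _ (retp s0 ^+ t)); last first.
    by apply: wprob_ret_lower; rewrite // /m leq_mul2r (ltnW tA) orbT.
  apply: (@le_trans _ _ (h ^+ t * (1 - K / x ^+ 4 / h) ^+ t)).
    by rewrite ler_pM2l // bernoulli_ge.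
  rewrite -exprMn lerXn2r ?nnegrE ?wprob_ge0 //.
    by rewrite mulr_ge0 ?(ltW h0) // subr_ge0; case/andP: xh.
  rewrite mulrBr mulr1 [X in _ - X](_ : _ = delta); first exact: deltaP.
  by rewrite /delta mulrC divfK // gt_eqF.
have tx : t%:R <= A%:R * x by rewrite /x -natrM ler_nat ltnW.
have theta_le : theta <= A%:R * K / h / x ^+ 3.
  rewrite /theta; apply: (@le_trans _ _ (A%:R * x * (K / x ^+ 4 / h))).
    by rewrite ler_wpM2r //; case/andP: xh.
  by rewrite le_eqVlt; apply/orP; left; apply/eqP; field; rewrite !gt_eqF.
have x30 : 0 < x ^+ 3 by rewrite exprn_gt0.
have theta_small : theta <= e / 8.
  apply: le_trans theta_le _; rewrite ler_pdivrMr //.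
  move: k2P; rewrite ler_pdivrMr ?divr_gt0 // => /le_trans; apply.
  by rewrite mulrC ler_pM2l ?divr_gt0 // px3.
have delta_le : delta <= K / x ^+ 3.
  by rewrite /delta ler_wpM2l // lef_pV2 ?posrE ?exprn_gt0 // pw.
have delta_small : delta <= (1 - h) * e / 4.
  apply: le_trans delta_le _; rewrite ler_pdivrMr //.
  move: k3P; rewrite ler_pdivrMr ?divr_gt0 ?mulr_gt0 // => /le_trans; apply.
  by rewrite mulrC ler_pM2l ?divr_gt0 ?mulr_gt0 // px3.
have m0 : (0 < m)%N by apply: leq_trans s0m.
have A1 : 1 <= A%:R :> R by rewrite ler1n.
have xm : x ^+ 9 <= C1 * rho ^+ k / x ^+ 3.
  by rewrite ler_pdivlMr // -exprD; exact: C1P.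
have m3 : (2 * m).+1%:R <= 3 * m%:R :> R by rewrite -natrM ler_nat; clear -m0; lia.
have mN : (2 * m).+1%:R <= e / 8 * N%:R.
  apply: le_trans m3 _; rewrite mE.
  apply: (@le_trans _ _ (3 * A%:R * (C1 * rho ^+ k / x ^+ 3))).
    by rewrite mulrA ler_wpM2l // mulr_ge0.
  rewrite !mulrA ler_pdivrMr //.
  apply: (@le_trans _ _ (e / 8 * x * rho ^+ k)).
    by rewrite ler_pM2r // [leRHS]mulrC -ler_pdivrMr ?divr_gt0.
  rewrite -mulrA -[leRHS]mulrA ler_pM2l ?divr_gt0 // mulrC.
  by apply: ler_pM => //; apply: ltW.
have tb : tail_bound D h eta F t m N e delta theta <= b.
  have T1 : 64 * (size F)%:R / (e * (1 - h)) ^+ 2 / (N%:R * h ^+ t) = B1 / (N%:R * h ^+ t) by [].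
  have T2 : 64 / (e * (1 - h)) ^+ 2 * (m%:R * (2 * m).+1%:R ^+ #|D|)
     * ((h + eta) ^+ (2 * t) / (N%:R * h ^+ (2 * t))) <= B2 / x ^+ 3.
    rewrite -[leLHS]mulrA /B2 -[leRHS]mulrA; apply: ler_wpM2l; first by apply: divr_ge0 => //; apply: sqr_ge0.
    rewrite ler_pdivlMr //.
    set Y := _ / (N%:R * h ^+ (2 * t)).
    have Y0 : 0 <= Y.
      by rewrite divr_ge0 ?mulr_ge0 ?exprn_ge0 ?addr_ge0 // ltW.
    (* Squaring makes the fourth power of [h + eta] appear; replaced by [h^3] it leaves
       [1 / (N h^t)], at most 1 by admissibility. *)
    have Y2 : Y ^+ 2 * rho ^+ k <= 1.
      apply: (@le_trans _ _ (Y ^+ 2 * N%:R)); first by rewrite ler_wpM2l ?sqr_ge0.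
      rewrite /Y expr_div_n -exprM (_ : 2 * t * 2 = 4 * t)%N; last by clear; lia.
      rewrite exprM; apply: (@le_trans _ _ ((h ^+ 3) ^+ t / (N%:R * h ^+ (2 * t)) ^+ 2 * N%:R)).
        rewrite ler_wpM2r // ler_wpM2r ?invr_ge0 ?sqr_ge0 // lerXn2r ?nnegrE ?exprn_ge0 ?addr_ge0 ?(ltW h0) //.
      have -> : (h ^+ 3) ^+ t / (N%:R * h ^+ (2 * t)) ^+ 2 * N%:R = (N%:R * h ^+ t)^-1.
        rewrite (mulnC 2 t) -exprM (mulnC 3 t) !exprM; field.
        by rewrite !gt_eqF.
      rewrite invf_le1 ?mulr_gt0 //; apply: le_trans kN.
      by rewrite -/x exprn_ege1.
    have P0 : m%:R * (2 * m).+1%:R ^+ #|D| * x ^+ 3 <= c0 * x ^+ p.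
      apply: (@le_trans _ _ (m%:R * (3 * m%:R) ^+ q * x ^+ 3)).
        rewrite ler_pM2r // ler_wpM2l // lerXn2r ?nnegrE ?mulr_ge0 //.
      have -> : m%:R * (3 * m%:R) ^+ q * x ^+ 3 = 3 ^+ q * m%:R ^+ q.+1 * x ^+ 3 :> R.
        by rewrite exprMn (exprS m%:R q) !mulrA [m%:R * _]mulrC.
      by rewrite mE exprMn -exprM /c0 /p exprD !mulrA.
    rewrite [leLHS](_ : _ = m%:R * (2 * m).+1%:R ^+ #|D| * x ^+ 3 * Y); last by ring.
    apply: (@le_trans _ _ (c0 * x ^+ p * Y)); first by rewrite ler_wpM2r.
    set z := _ * Y.
    have z2 : z ^+ 2 <= M.
      have zE (u v w : R) : (u * v * w) ^+ 2 = u ^+ 2 * (v ^+ 2 * w ^+ 2) by ring.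
      rewrite /z zE -exprM (mulnC p) /M ler_wpM2l ?sqr_ge0 //.
      apply: (@le_trans _ _ (C2 * rho ^+ k * Y ^+ 2)).
        by rewrite ler_wpM2r ?sqr_ge0 //; exact: C2P.
      by rewrite -mulrA ler_piMr ?(ltW C20) // mulrC.
    (* Only [z^2] is controlled; [z <= z^2 + 1] avoids a square root and explains [M + 1] in
       [B2]. *)
    apply: (@le_trans _ _ (z ^+ 2 + 1)); last by rewrite lerD2r.
    rewrite -subr_ge0 (_ : _ - z = (z - 2^-1) ^+ 2 + 3 / 4); last by field.
    by rewrite addr_ge0 ?sqr_ge0 // divr_ge0.
  have T3 : 2 / (e * (1 - h)) * (m%:R / N%:R + theta + delta) <= B3 / x ^+ 3.
    rewrite /B3 -[leRHS]mulrA; apply: ler_wpM2l; first by apply: divr_ge0 => //; apply: ltW.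
    rewrite [leRHS]mulrDl [X in _ <= X + _]mulrDl; apply: lerD => //; apply: lerD => //.
    rewrite mE ler_pdivrMr // -!mulrA; apply: ler_wpM2l => //.
    apply: le_trans xm _; rewrite -mulrA; apply: ler_wpM2l; first exact: ltW.
    by rewrite mulrC; apply: ler_wpM2l => //; rewrite invr_ge0 ltW.
  rewrite /tail_bound T1 /b; apply: le_trans (lerD (lerD (lexx _) T2) T3) _.
  rewrite -addrA -mulrDl lerD // ler_wpM2r ?invr_ge0 ?mulr_ge0 ?(ltW ht0) ?(ltW x30) //.
    by rewrite -addrA lerDl addr_ge0.
  by rewrite -addrA lerDr.
split=> //.
- move=> L LN; apply: le_trans tb; apply: lower_tail => //; exact: deltaP.
- exists (N + 2 * m)%N => L NL; apply: le_trans tb.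
  by apply: upper_tail => //; exact: deltaP.
Qed.

End Tails.

Local Open Scope classical_set_scope.
Local Open Scope ring_scope.

(** * Continuity from below, union bounds and Borel-Cantelli *)

Section Measure.
Variables (R : realType) (disp : measure_display) (Omega : measurableType disp).
Variable P : probability Omega R.

Lemma prob_fibers (T : finType) (f : Omega -> T) (B : set Omega) :
  (forall a, measurable [set w | B w /\ f w = a]) ->
  P B = (\sum_(a : T) P [set w | B w /\ f w = a])%E.
Proof.
move=> mB; have H (r : seq T) : uniq r ->
    P [set w | B w /\ f w \in r] = (\sum_(a <- r) P [set w | B w /\ f w = a])%E /\
    measurable [set w | B w /\ f w \in r].
  elim: r => [|a r IHr] /=.
    have -> : [set w | B w /\ f w \in [::]] = set0 by apply/seteqP; split=> w [].
    by rewrite big_nil measure0.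
  move=> /andP[ar /IHr[IHs mr]]; have -> : [set w | B w /\ f w \in a :: r] =
      [set w | B w /\ f w = a] `|` [set w | B w /\ f w \in r].
    apply/seteqP; split=> w /=; rewrite inE.
      by move=> [Bw /orP[/eqP|]]; [left|right].
    by move=> [[Bw ->]|[Bw ->]]; rewrite ?eqxx ?orbT.
  rewrite big_cons -IHs (measureU P) //; first by split=> //; exact: measurableU.
  by apply/seteqP; split=> w //= -[[_ fa] [_]]; rewrite fa; apply/negP.
have [<- _] := H _ (index_enum_uniq T); congr (P _).
by apply/seteqP; split=> w /=; rewrite mem_index_enum; [|case].
Qed.

Lemma prob_bigcup_le (A : nat -> set Omega) (c : R) :
  (forall n, measurable (A n)) -> {homo A : n m / (n <= m)%N >-> n `<=` m} ->
  (forall n, (P (A n) <= c%:E)%E) -> (P (\bigcup_n A n) <= c%:E)%E.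
Proof.
move=> mA hA Ac; have mU : measurable (\bigcup_n A n) by exact: bigcup_measurable.
have hA' : {homo A : n m / (n <= m)%N >-> (n <= m)%O}.
  by move=> n m nm; rewrite subsetEset; apply: hA.
have cvA := nondecreasing_cvg_mu (mu := P) mA mU hA'.
rewrite -(cvg_lim _ cvA) //; apply: lime_le; first by apply/cvg_ex; exists (P (\bigcup_n A n)).
by near=> n; apply: Ac.
Unshelve. all: by end_near. Qed.

Lemma prob_sum_le (A : nat -> set Omega) (b : nat -> R) n :
  (forall t, measurable (A t)) -> (forall t, (P (A t) <= (b t)%:E)%E) ->
  measurable (\big[setU/set0]_(t < n) A t) /\
  (P (\big[setU/set0]_(t < n) A t) <= (\sum_(t < n) b t)%:E)%E.
Proof.
move=> mA Ab; elim: n => [|n [mn IHn]]; first by rewrite !big_ord0 measure0.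
rewrite !big_ord_recr /=; split; first exact: measurableU.
apply: le_trans (measureU2 _ _ _) _ => //.
by rewrite EFinD leeD // Ab.
Qed.

Lemma sum_inv_sqr_le n : \sum_(k < n) (k.+1%:R ^+ 2)^-1 <= 2 :> R.
Proof.
case: n => [|n]; first by rewrite big_ord0.
apply: (@le_trans _ _ (2 - n.+1%:R^-1)); last by rewrite gerBl invr_ge0.
elim: n => [|n IHn]; first by rewrite big_ord_recr big_ord0 /= expr1n invr1; lra.
rewrite big_ord_recr /=; apply: le_trans (lerD IHn (lexx _)) _.
have n0 : 0 < n.+1%:R :> R by rewrite ltr0n.
rewrite -[n.+2%:R]natr1; set x := n.+1%:R in n0 *.
rewrite -subr_ge0 (_ : _ - _ = (x * (x + 1) ^+ 2)^-1); last by field; lra.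
by rewrite invr_ge0 mulr_ge0 ?sqr_ge0 // ltW.
Qed.

Lemma borel_cantelli_inv_sqr (A : nat -> set Omega) (c : R) : 0 <= c ->
  (forall k, measurable (A k)) -> (forall k, (P (A k.+1) <= (c / k.+1%:R ^+ 2)%:E)%E) ->
  {ae P, forall w, exists k0, forall k, (k0 <= k)%N -> ~ A k w}.
Proof.
move=> c0 mA Ac.
have : P (lim_sup_set (fun k => A k.+1)) = 0%E.
  apply: lim_sup_set_cvg0 => //; apply: (@le_lt_trans _ _ (c * 2)%:E); last by rewrite ltry.
  apply: lime_le; first by apply: is_cvg_nneseries => k _ _; apply: measure_ge0.
  near=> n; apply: (@le_trans _ _ (\sum_(0 <= k < n) (c / k.+1%:R ^+ 2)%:E)%E).
    by apply: lee_sum => k _; apply: Ac.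
  rewrite sumEFin lee_fin -mulr_sumr ler_wpM2l // big_mkord.
  exact: sum_inv_sqr_le.
move=> P0; exists (lim_sup_set (fun k => A k.+1)); split=> //.
  by apply: bigcap_measurable => // n _; apply: bigcup_measurable.
move=> w /= nw n _; apply: contrapT => nA; apply: nw; exists n.+1 => k nk Ak; apply: nA.
case: k nk Ak => // k nk Ak.
by exists k.
Unshelve. all: by end_near. Qed.

End Measure.

(** * From the probability space to words of directions *)

Section Transfer.
Variables (R : realType) (disp : measure_display) (Omega : measurableType disp).
Variables (P : probability Omega R) (d : nat) (X : nat -> Omega -> 'rV[int]_d).
Hypothesis hX : simple_walk_steps P X.
Hypothesis d0 : (0 < d)%N.

Local Notation D := ('I_d * bool)%type.

Lemma lstep_inj : injective (@lstep d).
Proof.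
have lstepE (a : D) j : lstep a 0 j = if j == a.1 then (if a.2 then 1 else -1) else 0.
  by rewrite /lstep; case: a.2; rewrite !mxE eqxx /=; case: eqP; rewrite ?oppr0.
move=> [i b] [i' b'] E; have := congr1 (fun y : 'rV[int]_d => y 0 i) E.
rewrite !lstepE eqxx /=; case: eqP => [-> |_]; last by case: b {E}.
by case: b b' {E} => -[].
Qed.

(** Vectors other than signed unit vectors get an arbitrary letter, so that words are defined on
    every path; such steps have probability zero. *)
Definition direction (y : 'rV[int]_d) : D :=
  odflt (Ordinal d0, true) [pick a | lstep a == y].

Lemma lstepK : cancel (@lstep d) direction.
Proof.
by move=> a; rewrite /direction; case: pickP => [b /eqP/lstep_inj //|/(_ a)]; rewrite eqxx.
Qed.

Definition dir k w : D := direction (X k w).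
Definition word o n w : seq D := mkseq (fun k => dir (o + k) w) n.

Lemma size_word o n w : size (word o n w) = n.
Proof. by rewrite size_mkseq. Qed.

Lemma word_cat o m n w : word o (m + n) w = word o m w ++ word (o + m) n w.
Proof.
rewrite /word /mkseq iotaD map_cat add0n; congr (_ ++ _).
by rewrite -[m in iota m]addn0 iotaDl -map_comp; apply: eq_map => i /=; rewrite addnA.
Qed.

Lemma card_dir : #|{: D}| = (2 * d)%N.
Proof. by rewrite card_prod card_ord card_bool mulnC. Qed.

Lemma card_dir_gt0 : (0 < #|{: D}|)%N.
Proof. by rewrite card_dir muln_gt0. Qed.

Let c : R := (#|{: D}|%:R)^-1.

Lemma prob_step k (a : D) : P (X k @^-1` [set lstep a]) = c%:E.
Proof.
have [_ _ /(_ k a.1)[P1 P2]] := hX.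
by rewrite /c card_dir natrM /lstep; case: a.2.
Qed.

Lemma measurable_dir k (B : set D) : measurable [set w | B (dir k w)].
Proof.
by have [mX _ _] := hX; apply: (mX k [set y | B (direction y)]).
Qed.

Lemma sum_c : \sum_(a : D) c = 1.
Proof.
by rewrite sumr_const -[_ *+ _]mulr_natl mulfV // pnatr_eq0 -lt0n card_dir_gt0.
Qed.

(** The default letter can only add mass to an event of probability [c]; as the lower bounds [c]
    already sum to 1, nothing is added. *)
Lemma prob_dir k (a : D) : P [set w | dir k w = a] = c%:E.
Proof.
have mset b : measurable [set w | dir k w = b] by apply: (measurable_dir k [set b]).
have ge b : (c%:E <= P [set w | dir k w = b])%E.
  rewrite -(prob_step k b); apply: le_measure; rewrite ?inE //.
    by have [mX _ _] := hX; exact: mX.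
  by move=> w /= E; rewrite /dir E lstepK.
have S : (\sum_(b : D) P [set w | dir k w = b] = 1)%E.
  rewrite -(probability_setT P) (@prob_fibers _ _ _ P D (dir k) setT).
    by apply: eq_bigr => b _; congr (P _); apply/seteqP; split=> w //= -[].
  by move=> b; rewrite (_ : [set w | _] = [set w | dir k w = b]) //; apply/seteqP; split=> w //= -[].
pose p b := fine (P [set w | dir k w = b]).
have pE b : P [set w | dir k w = b] = (p b)%:E by rewrite fineK // fin_num_measure.
have Sp : \sum_b (p b - c) = 0.
  rewrite sumrB sum_c; apply/eqP; rewrite subr_eq0; apply/eqP.
  by apply: EFin_inj; rewrite -S -sumEFin; apply: eq_bigr => b _; rewrite pE.
rewrite pE; congr (_%:E); apply/eqP; rewrite -subr_eq0; apply/eqP.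
apply: (psumr_eq0P _ Sp) => // b _.
by rewrite subr_ge0 -lee_fin -pE.
Qed.

Lemma measurable_word o n (E : seq D -> bool) : measurable [set w | E (word o n w)].
Proof.
elim: n o E => [|n IHn] o E.
  have -> : [set w | E (word o 0 w)] = [set w | E [::]] by [].
  by case: (E [::]); [rewrite (_ : [set w | _] = setT) // | rewrite (_ : [set w | _] = set0) //];
    apply/seteqP; split.
have wordS w : word o n.+1 w = dir o w :: word o.+1 n w.
  rewrite /word /mkseq /= addn0 -[1%N]addn0 iotaDl -map_comp; congr (_ :: _).
  by apply: eq_map => k /=; rewrite addnA addn1.
have -> : [set w | E (word o n.+1 w)] =
    \bigcup_(a in [set: D]) ([set w | dir o w = a] `&` [set w | E (a :: word o.+1 n w)]).
  apply/seteqP; split=> w /=; first by rewrite wordS => Ew; exists (dir o w).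
  by move=> [a _ [<-]] /=; rewrite wordS.
apply: fin_bigcup_measurable; first exact: finite_finset.
move=> a _; apply: measurableI; first exact: (measurable_dir o [set a]).
exact: (IHn o.+1 (fun s => E (a :: s))).
Qed.

Lemma prob_word_eq o (u : seq D) : P [set w | word o (size u) w = u] = (c ^+ size u)%:E.
Proof.
have [_ ind _] := hX; pose a0 : D := (Ordinal d0, true).
pose J := [fset k in iota o (size u)]%fset.
have := ind J (fun k => [set y | direction y = nth a0 u (k - o)]).
have -> : \bigcap_(k in [set` J]) (X k @^-1` [set y | direction y = nth a0 u (k - o)]) =
    [set w | word o (size u) w = u].
  apply/seteqP; split=> w /=.
    move=> H; apply: (@eq_from_nth _ a0); rewrite size_word // => i iu.
    rewrite nth_mkseq //; have := H (o + i)%N; rewrite /= !inE mem_iota leq_addr ltn_add2l iu.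
    by move=> /(_ isT); rewrite addKn.
  move=> H k; rewrite /= !inE mem_iota => /andP[ok ko].
  have ku : (k - o < size u)%N by rewrite ltn_subLR.
  by rewrite -[in RHS]H nth_mkseq // subnKC.
move=> ->; rewrite big_seq (eq_bigr (fun=> c%:E)) => [|k _]; last exact: prob_dir.
rewrite -big_seq prodEFin; congr (_%:E).
rewrite big_const_seq count_predT -Monoid.iteropE.
have -> : size J = size u.
  rewrite -[LHS]/(#|` J|) card_fseq undup_id ?iota_uniq // size_iota.
  by [].
by rewrite /GRing.exp; case: (size u).
Qed.

(** The prefix [u] absorbs the letters one at a time, so the induction on [n] ends with events that
    fix the whole word, where the independence of the steps applies. *)
Lemma prob_prefix_word o (u : seq D) n (E : seq D -> bool) :
  P [set w | word o (size u) w = u /\ E (word (o + size u) n w)] = (c ^+ size u * wprob n E)%:E.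
Proof.
elim: n u E => [|n IHn] u E.
  rewrite /wprob /=; case: (E [::]) (erefl (E [::])) => e0.
    rewrite mulr1 -(prob_word_eq o u); congr (P _).
    by apply/seteqP; split=> w /=; [case|move=> ->].
  rewrite mulr0 (_ : [set w | _] = set0) ?measure0 //.
  by apply/seteqP; split=> w //= -[].
have key a : [set w | (word o (size u) w = u /\ E (word (o + size u) n.+1 w))
      /\ dir (o + size u) w = a] =
    [set w | word o (size (rcons u a)) w = rcons u a /\ E (a :: word (o + size (rcons u a)) n w)].
  have w1 w : word (o + size u) 1 w = [:: dir (o + size u) w] by rewrite /word /mkseq /= addn0.
  have wS w : word (o + size u) n.+1 w = dir (o + size u) w :: word (o + size (rcons u a)) n w.
    rewrite size_rcons addnS /word /mkseq /= addn0 -[1%N]addn0 iotaDl -map_comp; congr (_ :: _).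
    by apply: eq_map => k /=; rewrite addnA addn1.
  apply/seteqP; split=> w /=.
    by move=> [[wu Ew] da]; move: Ew; rewrite wS da size_rcons -addn1 word_cat wu w1 da cats1.
  rewrite [in word o _ w]size_rcons -addn1 word_cat w1 cats1 => -[/eqP].
  by rewrite eqseq_rcons => /andP[/eqP wu /eqP da] Ew; rewrite wS da.
rewrite (@prob_fibers _ _ _ P D (dir (o + size u))); last first.
  move=> a; rewrite key; pose E' s := (take (size (rcons u a)) s == rcons u a) &&
     E (a :: drop (size (rcons u a)) s).
  rewrite (_ : [set w | _] = [set w | E' (word o (size (rcons u a) + n) w)]).
    exact: measurable_word.
  apply/seteqP; split=> w /=; rewrite /E' word_cat take_size_cat ?size_word // drop_size_cat ?size_word //.
    by move=> [-> ->]; rewrite eqxx.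
  by move=> /andP[/eqP -> ->].
under eq_bigr do rewrite key (IHn _ (fun s => E (_ :: s))).
rewrite sumEFin; congr (_%:E); rewrite /wprob /= -/c mulr_sumr mulr_sumr.
by apply: eq_bigr => a _; rewrite size_rcons exprSr mulrA.
Qed.

Lemma prob_word o n (E : seq D -> bool) :
  P [set w | E (word o n w)] = (wprob n E)%:E.
Proof.
have := prob_prefix_word o [::] n E; rewrite /= expr0 mul1r addn0 => <-.
by congr (P _); apply/seteqP; split=> w //= -[].
Qed.

Lemma ae_step : {ae P, forall w, forall k, X k w = lstep (dir k w)}.
Proof.
apply: ae_foralln => k; pose G := [set w | X k w = lstep (dir k w)].
have mG : measurable G.
  by have [mX _ _] := hX; apply: (mX k [set y | y = lstep (direction y)]).
have PG : P G = 1%E.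
  rewrite (@prob_fibers _ _ _ P D (dir k)).
    rewrite -sum_c -sumEFin; apply: eq_bigr => a _; rewrite -(prob_step k a); congr (P _).
    apply/seteqP; split=> w /=; first by move=> [+ <-].
    by move=> E; rewrite /G /= /dir E lstepK.
  move=> a; have [mX _ _] := hX.
  by apply: (mX k [set y | y = lstep (direction y) /\ direction y = a]).
exists (~` G); split; [exact: measurableC| |by []].
by apply: etrans (probability_setC P mG) _; rewrite PG subee.
Qed.

Lemma walk_word n w : (forall k, X k w = lstep (dir k w)) ->
  walk X n w = pos (@lstep d) (word 0 n w).
Proof.
move=> Xw; rewrite /walk /pos big_map.
have -> : iota 0 n = index_iota 0 n by rewrite /index_iota subn0.
by rewrite big_mkord; apply: eq_bigr => k _; rewrite Xw.
Qed.

Lemma take_word o m n w : (m <= n)%N -> take m (word o n w) = word o m w.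
Proof. by move=> mn; rewrite -(subnKC mn) word_cat take_size_cat // size_word. Qed.

Lemma drop_word o m n w : (m <= n)%N -> drop m (word o n w) = word (o + m) (n - m) w.
Proof. by move=> mn; rewrite -{1}(subnKC mn) word_cat drop_size_cat // size_word. Qed.

End Transfer.

(** * Return probability and almost sure concentration for the walk *)

Lemma wprob_gt0 (R : realType) (D : finType) n (E : seq D -> bool) (s : seq D) :
  (0 < #|D|)%N -> size s = n -> E s -> 0 < wprob n E :> R.
Proof.
move=> D0; elim: n E s => [|n IHn] E [|a s] //=.
  by move=> _ Es; rewrite /wprob /= Es ltr01.
move=> [sn] Es.
rewrite /wprob /= mulr_gt0 ?invr_gt0 ?ltr0n //.
rewrite (bigD1 a) //= ltr_pwDl ?(IHn (fun s => E (a :: s)) s) //.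
by apply: sumr_ge0 => b _; apply: wmean_ge0.
Qed.

Section Walk.
Variables (R : realType) (disp : measure_display) (Omega : measurableType disp).
Variables (P : probability Omega R) (d : nat) (X : nat -> Omega -> 'rV[int]_d).
Hypothesis hX : simple_walk_steps P X.
Hypothesis hd : (3 <= d)%N.

Variable d0 : (0 < d)%N.
Let D0 : (0 < #|{: 'I_d * bool}|)%N. Proof. exact: card_dir_gt0. Qed.

Local Notation word := (word X d0).
Local Notation ret := (ret (@lstep d)).
Local Notation retp := (retp (@lstep d) R).
Local Notation h := (1 - escape_prob P X).

Let K : R := 8 * d%:R ^+ 3.
Let K0 : 0 <= K. Proof. by rewrite mulr_ge0 ?exprn_ge0. Qed.
Let loc k (x : 'rV[int]_d) :
  wprob k.+1 (fun s => pos (@lstep d) s == x) <= K * (isqrt R k.+1 - isqrt R k.+2).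
Proof. exact: local_bound. Qed.

Lemma lattice_rv_walk n : lattice_rv (walk X n).
Proof.
have [mX _ _] := hX; elim: n => [|n IHn] A.
  rewrite (_ : _ @^-1` A = [set w | A 0]); last first.
    by apply/seteqP; split=> w /=; rewrite /walk big_ord0.
  have [A0|A0] := pselect (A 0).
    by rewrite (_ : [set _ | _] = setT) //; apply/seteqP; split.
  by rewrite (_ : [set _ | _] = set0) //; apply/seteqP; split.
(* The last step takes countably many values, enumerated by [unpickle]; for each of them the event
   is an intersection of preimages. *)
have -> : walk X n.+1 @^-1` A = \bigcup_(i in [set: nat])
   [set w | exists y : 'rV[int]_d, choice.unpickle i = Some y /\ (X n w = y /\ A (walk X n w + y))].
  apply/seteqP; split=> w /=.
    by rewrite /walk big_ord_recr /= => Aw; exists (choice.pickle (X n w)) => //; exists (X n w); rewrite choice.pickleK.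
  by move=> [i _ /= [y [_ [<- Ay]]]]; rewrite /walk big_ord_recr.
apply: bigcup_measurable => i _; case: (choice.unpickle i : option 'rV[int]_d) => [y|]; last first.
  by rewrite (_ : [set _ | _] = set0) //; apply/seteqP; split=> w //= -[y []].
rewrite (_ : [set _ | _] = (X n @^-1` [set y]) `&` (walk X n @^-1` [set z | A (z + y)])).
  by apply: measurableI; [exact: mX|exact: IHn].
by apply/seteqP; split=> w /=; [move=> [z [[<-]]]|move=> []; exists y].
Qed.

Lemma prob_ae_le (E E' : set Omega) : measurable E -> measurable E' ->
  {ae P, forall w, E w -> E' w} -> (P E <= P E')%E.
Proof.
move=> mE mE' [N [mN N0 EN]].
apply: (@le_trans _ _ (P (E' `|` N))).
  apply: le_measure; rewrite ?inE //; first exact: measurableU.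
  move=> w Ew; have [E'w|nE'w] := pselect (E' w); [by left|right].
  by apply: EN => /= H; apply: nE'w; apply: H.
have PN : (P N <= 0)%E by rewrite le_eqVlt; apply/orP; left; apply/eqP; exact: N0.
by apply: le_trans (measureU2 _ _ _) _ => //; rewrite -[leRHS]adde0; exact: leeD (lexx _) PN.
Qed.

Let A n := [set w | (0 < ret (word 0 n w))%N].

Let mA n : measurable (A n).
Proof. exact: (measurable_word hX d0 0 n (fun s => 0 < ret s)%N). Qed.

Let PA n : P (A n) = (retp n)%:E.
Proof. exact: (prob_word hX d0 0 n (fun s => 0 < ret s)%N). Qed.

Let homoA : {homo A : n m / (n <= m)%N >-> n `<=` m}.
Proof.
move=> n m nm w; rewrite /A /= => /leq_trans; apply.
by rewrite -(take_word _ _ _ _ nm) vis_take.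
Qed.

(** [escape_prob] speaks of positions and [A n] of words; the events are complementary on paths made
    of unit steps, hence up to a null set. *)
Lemma return_probE : P (\bigcup_n A n) = h%:E.
Proof.
have mU : measurable (\bigcup_n A n) by exact: bigcup_measurable.
pose E := [set w | forall k, (1 <= k)%N -> walk X k w <> 0].
have mE : measurable E.
  have -> : E = \bigcap_(k in [set k | (1 <= k)%N]) (walk X k @^-1` [set y | y <> 0]).
    by apply/seteqP; split=> w H k /= k1; apply: H.
  by apply: bigcap_measurable; [exists 1%N|move=> k _; apply: lattice_rv_walk].
have retE w : (forall k, X k w = lstep (dir X d0 k w)) -> E w <-> (~` \bigcup_n A n) w.
  move=> Xw; split.
    move=> Ew [n _]; rewrite /A /= => /ret_gt0P[k]; rewrite size_word => /andP[k0 kn].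
    by rewrite take_word // -walk_word //; apply: Ew.
  move=> nU k k1; rewrite (walk_word _ Xw) => W; apply: nU; exists k => //.
  apply/ret_gt0P; exists k; first by rewrite size_word k1 leqnn.
  by rewrite take_oversize ?size_word.
have PE : P E = P (~` \bigcup_n A n).
  apply/eqP; rewrite eq_le; apply/andP; split; apply: prob_ae_le => //; try exact: measurableC;
    by have := ae_step hX d0; apply: filterS => w /retE [].
have fU : P (\bigcup_n A n) \is a fin_num by apply: fin_num_measure.
rewrite /escape_prob -/E PE probability_setC // -(fineK fU) -EFinB /=.
by rewrite opprB addrC subrK.
Qed.

Lemma retp_le_h n : retp n <= h.
Proof.
rewrite -lee_fin -return_probE -PA.
apply: le_measure; [rewrite inE; exact: (mA n)|rewrite inE; exact: bigcup_measurable|].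
by move=> w Aw; exists n.
Qed.

Lemma h_le_retp m : h <= retp m + K * isqrt R m.+1.
Proof.
rewrite -lee_fin -return_probE; apply: prob_bigcup_le => // n.
by rewrite PA lee_fin; apply: retp_tail.
Qed.

Lemma h_gt0 : 0 < h.
Proof.
apply: lt_le_trans (retp_le_h 2).
pose u := [:: (Ordinal d0, true); (Ordinal d0, false)].
have u0 : (0 < ret u)%N.
  apply/ret_gt0P; exists 2%N => //; rewrite /= /pos !big_cons big_nil /lstep /=.
  by rewrite addr0 subrr.
exact: (@wprob_gt0 R _ 2 (fun s => 0 < ret s)%N u).
Qed.

Lemma h_lt1 : h < 1.
Proof. exact: (return_prob_lt1 D0 K0 loc h_le_retp). Qed.

Lemma visited_count_word_mono t N H H' w : (N <= H <= H')%N ->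
  (visited_count (@lstep d) t N (word 1 H w) <= visited_count (@lstep d) t N (word 1 H' w))%N.
Proof.
move=> /andP[NH HH']; apply: leq_sum => i _; have iN := ltn_ord i.
have iH : (i <= H)%N by lia.
have iH' : (i <= H')%N by lia.
rewrite /new !take_word // !drop_word //; case: (_ == _) => //=.
have [t1|] //= := boolP (t <= ret (word (1 + i) (H - i) w))%N; rewrite lt0b.
apply: leq_trans t1 _; rewrite -(take_word _ _ _ _ (leq_sub2r i HH')).
exact: vis_take.
Qed.

(** The lower bound is at the shortest horizon and the upper bound at every horizon, so by
    monotonicity both hold at all horizons from [N - 1] on. *)
Definition concentrated (rho e : R) w := exists k1, forall k, (k1 <= k)%N -> forall t,
  let N := scale rho k in k%:R ^+ 2 <= N%:R * h ^+ t ->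
  (1 - e) * (N%:R * (1 - h) * h ^+ t) <= (visited_count (@lstep d) t N (word 1 N.-1 w))%:R /\
  forall H, (N <= H)%N ->
    (visited_count (@lstep d) t N (word 1 H w))%:R <= (1 + e) * (N%:R * (1 - h) * h ^+ t).

Lemma ae_concentrated rho e : 1 < rho -> 0 < e <= 1 ->
  {ae P, forall w, concentrated rho e w}.
Proof.
move=> r1 e01.
have [C [k0 [a [C0 H]]]] := tails_summable D0 K0 loc retp_le_h h_le_retp h_gt0 r1 e01.
pose N k := scale rho k.
pose cond k t := (k0 <= k)%N && (k%:R ^+ 2 <= (N k)%:R * h ^+ t).
pose m k t := (N k)%:R * (1 - h) * h ^+ t.
pose Low k t := [set w | (visited_count (@lstep d) t (N k) (word 1 (N k).-1 w))%:R < (1 - e) * m k t].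
pose Up k t j := [set w | (1 + e) * m k t < (visited_count (@lstep d) t (N k) (word 1 (N k + j) w))%:R].
pose Bad k t := if cond k t then Low k t `|` \bigcup_j Up k t j else set0.
pose b k t : R := C / ((N k)%:R * h ^+ t) + C / k%:R ^+ 3.
pose bb k t := if cond k t then 2 * b k t else 0.
have mLow k t : measurable (Low k t).
  exact: (measurable_word hX d0 1 _ (fun s => (visited_count (@lstep d) t (N k) s)%:R < (1 - e) * m k t)).
have mUp k t j : measurable (Up k t j).
  exact: (measurable_word hX d0 1 _ (fun s => (1 + e) * m k t < (visited_count (@lstep d) t (N k) s)%:R)).
have PLow k t : P (Low k t) = (wprob (N k).-1 (fun s => (visited_count (@lstep d) t (N k) s)%:R < (1 - e) * m k t))%:E.
  exact: (prob_word hX d0 1 _ (fun s => (visited_count (@lstep d) t (N k) s)%:R < (1 - e) * m k t)).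
have PUp k t j : P (Up k t j) = (wprob (N k + j) (fun s => (1 + e) * m k t < (visited_count (@lstep d) t (N k) s)%:R))%:E.
  exact: (prob_word hX d0 1 _ (fun s => (1 + e) * m k t < (visited_count (@lstep d) t (N k) s)%:R)).
have mBad k t : measurable (Bad k t).
  rewrite /Bad; case: ifP => // _; apply: measurableU => //.
  by apply: bigcup_measurable => j _.
have homoUp k t : {homo Up k t : n m / (n <= m)%N >-> n `<=` m}.
  move=> i j ij w; rewrite /Up /= => /lt_le_trans; apply; rewrite ler_nat.
  by apply: visited_count_word_mono; rewrite leq_addr leq_add2l.
have PBad k t : (P (Bad k t) <= (bb k t)%:E)%E.
  rewrite /Bad /bb; case: ifP => [/andP[kk kN]|_]; last by rewrite measure0.
  have [_ HL [L0 HU]] := H k t kk kN.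
  have mU : measurable (\bigcup_j Up k t j) by apply: bigcup_measurable.
  have bL : (P (Low k t) <= (b k t)%:E)%E by rewrite PLow lee_fin; apply: HL.
  have bU : (P (\bigcup_j Up k t j) <= (b k t)%:E)%E.
    (* A longer horizon enlarges the event, so the bound for long horizons covers the short ones. *)
    apply: prob_bigcup_le => // j; apply: (@le_trans _ _ (P (Up k t (j + L0)%N))).
      by apply: le_measure; rewrite ?inE //; apply: homoUp; rewrite leq_addr.
    by rewrite PUp lee_fin; apply: HU; rewrite addnA leq_addl.
  apply: le_trans (measureU2 _ (mLow k t) mU) _.
  by rewrite mulr2n mulrDl mul1r EFinD; exact: leeD bL bU.
pose BadK k := \big[setU/set0]_(t < a * k) Bad k t.
have PK k := prob_sum_le (a * k) (mBad k) (PBad k).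
have g0 : 0 < 1 - h by rewrite subr_gt0 h_lt1.
pose c := 2 * C / (1 - h) + 2 * C * a%:R.
have c0 : 0 <= c by rewrite /c addr_ge0 ?mulr_ge0 ?invr_ge0 // ltW.
have sumK k : \sum_(t < a * k.+1) bb k.+1 t <= c / k.+1%:R ^+ 2.
  set x : R := k.+1%:R; have x0 : 0 < x by rewrite ltr0n.
  pose f t := ((N k.+1)%:R * h ^+ t)^-1.
  have N0 : 0 < (N k.+1)%:R :> R by rewrite ltr0n.
  have f0 t : 0 < f t by rewrite invr_gt0 mulr_gt0 // exprn_gt0 ?h_gt0.
  (* Admissibility reads [f t <= x^(-2)], so the geometric part sums to at most [x^(-2) / (1 - h)]
     up to [2 C]; the [a x] constant terms add another multiple of [x^(-2)]. *)
  apply: (@le_trans _ _ (\sum_(t < a * k.+1 | f t <= (x ^+ 2)^-1) 2 * C * f t +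
     \sum_(t < a * k.+1) 2 * C / x ^+ 3)).
    rewrite [X in _ <= X + _]big_mkcond -big_split; apply: ler_sum => t _ /=.
    rewrite /bb /cond -/x; case: ifP => [/andP[_ kN]|_]; last first.
      rewrite addr_ge0 ?divr_ge0 ?mulr_ge0 ?exprn_ge0 ?(ltW x0) //.
      by case: ifP => // _; rewrite !mulr_ge0 // ltW.
    rewrite ifT /b -/x; first by rewrite mulrDr !mulrA.
    by rewrite /f lef_pV2 ?posrE ?exprn_gt0 // mulr_gt0 // exprn_gt0 ?h_gt0.
  rewrite -mulr_sumr sumr_const card_ord -[_ *+ (a * _)]mulr_natl natrM -/x.
  have := @sum_inv_geom_le R h (x ^+ 2)^-1 f (a * k.+1).
  rewrite h_gt0 h_lt1 => /(_ isT _ f0 _) S.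
  have {}S : \sum_(t < a * k.+1 | f t <= (x ^+ 2)^-1) f t <= (x ^+ 2)^-1 / (1 - h).
    apply: S; first by rewrite invr_ge0 exprn_ge0 ?(ltW x0).
    by move=> t; rewrite /f exprS !invfM mulrCA mulVKf // gt_eqF ?h_gt0.
  apply: le_trans (lerD (ler_wpM2l _ S) (lexx _)) _; first by rewrite mulr_ge0.
  rewrite le_eqVlt; apply/orP; left; apply/eqP; rewrite /c; field.
  by rewrite !gt_eqF.
have BC : {ae P, forall w, exists k1, forall k, (k1 <= k)%N -> ~ BadK k w}.
  apply: (borel_cantelli_inv_sqr c0) => k; first by have [] := PK k.
  by have [_ /le_trans] := PK k.+1; apply; rewrite lee_fin.
move: BC; apply: filterS => w [k1 k1P]; exists (k0 + k1)%N => k kk t Nk kN.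
have kk0 : (k0 <= k)%N by lia.
have [ta _ _] := H k t kk0 kN.
have nb : ~ Bad k t w.
  move=> bw; apply: (k1P k); first by lia.
  by rewrite /BadK (bigD1 (Ordinal ta)) //=; left.
have cN : cond k t by rewrite /cond kk0.
split; first by rewrite leNgt; apply/negP => lw; apply: nb; rewrite /Bad cN; left.
move=> j Nj; rewrite leNgt; apply/negP => lw; apply: nb; rewrite /Bad cN; right.
by exists (j - N k)%N => //; rewrite /Up /= subnKC.
Qed.

(** At least [M] returns have probability at most [h^M] at every horizon; letting [M] grow gives
    transience from each time [o]. *)
Lemma ae_finite_returns : {ae P, forall w, forall o, exists M, forall L, (ret (word o L w) <= M)%N}.
Proof.
apply: ae_foralln => o.
pose B M L := [set w | (M <= ret (word o L w))%N].
have mB M L : measurable (B M L) by apply: (measurable_word hX d0 o L (fun s => M <= ret s)%N).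
pose Z := \bigcap_M \bigcup_L B M L.
have mU M : measurable (\bigcup_L B M L) by apply: bigcup_measurable.
have mZ : measurable Z by apply: bigcap_measurable.
have PU M : (P (\bigcup_L B M L) <= (h ^+ M)%:E)%E.
  apply: prob_bigcup_le => // [i j ij w|L].
    by rewrite /B /= => /leq_trans; apply; rewrite -(take_word _ _ _ _ ij) vis_take.
  rewrite (prob_word hX d0 o L (fun s => M <= ret s)%N) lee_fin.
  by apply: wprob_ret_geom => //; apply: retp_le_h.
have PZ0 : P Z = 0%E.
  have fZ : P Z \is a fin_num by apply: fin_num_measure.
  apply/eqP; rewrite eq_le measure_ge0 andbT -(fineK fZ) lee_fin.
  rewrite leNgt; apply/negP => z0.
  have hV : 1 < h^-1 by rewrite invf_gt1 ?h_gt0 ?h_lt1.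
  have [C C0 CP] := linear_le_exp hV.
  have [M MP] := nat_ge_eventually (C / fine (P Z) + 1).
  have := MP M (leqnn _); have := CP M.
  have hM : 0 < h ^+ M by rewrite exprn_gt0 ?h_gt0.
  have : fine (P Z) <= h ^+ M.
    rewrite -lee_fin fineK //; apply: le_trans (PU M).
    by apply: le_measure; rewrite ?inE // => w; apply.
  rewrite exprVn => zh; rewrite ler_pdivlMr // => Mh ZM.
  have : C / fine (P Z) + 1 <= C / fine (P Z).
    apply: le_trans ZM _; rewrite ler_pdivlMr //; apply: le_trans Mh.
    by rewrite ler_wpM2l.
  by rewrite gerDl ler10.
exists Z; split=> //.
move=> w /= nw M _; apply: contrapT => nM; apply: nw; exists M => L.
rewrite leqNgt; apply/negP => ML; apply: nM; exists L => //.
exact: ltnW.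
Qed.

End Walk.

(** * The local time statistics of a fixed path, counted by first visits *)

Lemma card_fset_set_count (T : choiceType) (r : seq T) (p : pred T) (A : set T) :
  uniq r -> (forall x, A x <-> (x \in r) && p x) -> #|` fset_set A| = count p r.
Proof.
move=> ur Ap; have -> : A = [set` [fset x in [seq x <- r | p x]]%fset].
  apply/seteqP; split=> x /=.
    by move=> /Ap /andP[xr px]; rewrite inE mem_filter px.
  by rewrite inE mem_filter => /andP[px xr]; apply/Ap; rewrite xr.
by rewrite set_fsetK card_fseq undup_id ?filter_uniq // size_filter.
Qed.

(** Counting distinct values at their first occurrences turns a number of lattice points into a sum
    over times. *)
Lemma count_undup_first (T : eqType) (f : nat -> T) (p : pred T) n :
  count p (undup [seq f i | i <- iota 0 n]) =
  (\sum_(i < n) ((f i \notin [seq f l | l <- iota 0 i]) && p (f i)))%N.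
Proof.
elim: n => [|n IHn]; first by rewrite big_ord0.
have iS : iota 0 n.+1 = rcons (iota 0 n) n by rewrite -addn1 iotaD cats1 add0n.
rewrite iS map_rcons big_ord_recr /= -IHn.
set s := map f (iota 0 n); set x := f n.
have [xs|xs] /= := boolP (x \in s).
  rewrite addn0; apply/permP/uniq_perm; rewrite ?undup_uniq // => y.
  by rewrite !mem_undup mem_rcons inE; case: eqP => // ->.
have : perm_eq (undup (rcons s x)) (rcons (undup s) x).
  apply: uniq_perm; rewrite ?undup_uniq // ?rcons_uniq ?mem_undup ?xs ?undup_uniq // => y.
  by rewrite mem_undup !mem_rcons !inE mem_undup.
by move=> /permP ->; rewrite -cats1 count_cat /= addn0.
Qed.

Lemma count_iota1 (p : pred nat) n : count p (iota 1 n) = (\sum_(l < n) p l.+1)%N.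
Proof.
rewrite -(big_mkord xpredT (fun l => p l.+1 : nat)) /index_iota subn0.
have -> : iota 1 n = map S (iota 0 n).
  by rewrite -[1%N]addn0 iotaDl; apply: eq_map.
rewrite count_map -sum1_count big_mkcond; apply: eq_bigr => l _ /=.
by case: (p _).
Qed.

Lemma limn_sum_count (R : realType) n (a : 'I_n -> bool) (v : 'I_n -> nat)
    (c : nat -> nat) k : (forall j, (k <= j)%N -> c j = (\sum_(i < n) (a i && (v i == j)))%N) ->
  limn (fun m => \sum_(k <= j < m) (c j)%:R : R) = (\sum_(i < n) (a i && (k <= v i)%N))%N%:R.
Proof.
move=> cE; apply: lim_near_cst => //; exists (\max_(i < n) v i).+1 => // m /= vm.
rewrite -natr_sum; congr _%:R.
rewrite (eq_big_nat _ _ (F2 := fun j => \sum_(i < n) (a i && (v i == j)))%N); last first.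
  by move=> j /andP[kj _]; apply: cE.
rewrite exchange_big /=; apply: eq_bigr => i _.
have vi : (v i < m)%N by apply: leq_ltn_trans vm; apply: leq_bigmax.
have [kv|vk] := leqP k (v i); last first.
  by rewrite andbF big_nat big1 // => j /andP[kj _]; case: eqP => [vj|]; rewrite ?andbF //; lia.
rewrite andbT (bigD1_seq (v i)) ?mem_index_iota ?iota_uniq ?kv //= eqxx andbT.
by rewrite big1 ?addn0 // => j /negbTE jv; rewrite eq_sym jv andbF.
Qed.

Section Deterministic.
Variables (R : realType) (disp : measure_display) (Omega : measurableType disp).
Variables (d : nat) (X : nat -> Omega -> 'rV[int]_d).
Variables (d0 : (0 < d)%N) (w : Omega).
Hypothesis Xw : forall k, X k w = lstep (dir X d0 k w).

Local Notation word := (word X d0).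
Local Notation ret := (ret (@lstep d)).
Local Notation pos := (pos (@lstep d)).
Local Notation S n := (walk X n w).

Lemma pos_word o n : pos (word o n w) = S (o + n) - S o.
Proof. by rewrite !(walk_word _ Xw) word_cat pos_cat addrAC subrr add0r. Qed.

Lemma ret_word o L : ret (word o L w) = (\sum_(l < L) (S (o + l).+1 == S o))%N.
Proof.
rewrite /ret visE size_word; apply: eq_bigr => l _ /=.
by rewrite take_word // pos_word add0r subr_eq0 addnS.
Qed.

Lemma new_word i H : (i <= H)%N ->
  new (@lstep d) i (word 1 H w) = (S i.+1 \notin [seq S l.+1 | l <- iota 0 i]).
Proof.
move=> iH; rewrite /new take_word // -leqn0 leqNgt; congr (~~ _).
apply/ret_gt0P/mapP => [[k]|[l]].
  rewrite size_rev size_word => /andP[k0 ki].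
  rewrite take_rev pos_rev size_word drop_word ?leq_subr // pos_word => /eqP.
  rewrite subr_eq0 => /eqP E; exists (i - k)%N; first by rewrite mem_iota; lia.
  by move: E; rewrite (_ : 1 + _ + _ = i.+1)%N; last by lia.
rewrite mem_iota => /andP[_ li] E; exists (i - l)%N; first by rewrite size_rev size_word; lia.
rewrite take_rev pos_rev size_word drop_word ?leq_subr // pos_word; apply/eqP.
rewrite subr_eq0; apply/eqP; rewrite (_ : 1 + _ + _ = i.+1)%N; last by lia.
by rewrite E; congr (S _); lia.
Qed.

Definition visits x n : nat := (\sum_(l < n) (S l.+1 == x))%N.

Lemma local_timeE x n : local_time X x n w = visits x n.
Proof.
rewrite /local_time (@card_fset_set_count _ (iota 1 n) (fun k => S k == x)) ?iota_uniq //.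
  by rewrite count_iota1.
move=> k; rewrite mem_iota add1n ltnS; split.
  by move=> [-> /eqP ->].
by move=> /andP[k1 /eqP].
Qed.

(** The added one is the first visit itself, which [ret] does not count. *)
Lemma visits_new i n : (i < n)%N -> S i.+1 \notin [seq S l.+1 | l <- iota 0 i] ->
  visits (S i.+1) n = (ret (word i.+1 (n - i.+1) w)).+1.
Proof.
move=> iln nw; rewrite /visits ret_word -(big_mkord xpredT (fun l => S l.+1 == S i.+1 : nat)).
rewrite (@big_cat_nat _ _ _ i) //=; last exact: ltnW.
rewrite big_nat big1 ?add0n => [|l /andP[_ li]]; last first.
  case: eqP => // E; case/negP: nw; apply/mapP; exists l => //.
  by rewrite mem_iota.
rewrite big_ltn // eqxx add1n; congr _.+1.
rewrite -{1}[i.+1]add0n big_addn big_mkord; apply: eq_bigr => l _.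
by rewrite addnC addSn.
Qed.

Lemma visited_countE t n H : (n <= H.+1)%N ->
  visited_count (@lstep d) t n (word 1 H w) =
  (\sum_(i < n) ((S i.+1 \notin [seq S l.+1 | l <- iota 0 i]) && (t < visits (S i.+1) H.+1)))%N.
Proof.
move=> nH; apply: eq_bigr => i _; have iN := ltn_ord i.
have iH : (i <= H)%N by lia.
rewrite new_word // drop_word //.
have [nw|] //= := boolP (S i.+1 \notin _).
by rewrite visits_new // ?ltnS // subSS add1n.
Qed.

Lemma visited_count_mono t n n' H H' : (n <= H.+1)%N -> (n <= n')%N -> (H <= H')%N ->
   (n' <= H'.+1)%N ->
  (visited_count (@lstep d) t n (word 1 H w) <= visited_count (@lstep d) t n' (word 1 H' w))%N.
Proof.
move=> nH nn' HH' nH'; rewrite !visited_countE //.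
apply: (@leq_trans (\sum_(i < n) ((S i.+1 \notin [seq S l.+1 | l <- iota 0 i])
   && (t < visits (S i.+1) H'.+1)))).
  apply: leq_sum => i _; case: (_ \notin _) => //=.
  have [tv|] //= := ltnP t (visits (S i.+1) H.+1); rewrite lt0b.
  apply: leq_trans tv _; rewrite /visits.
  rewrite -(big_mkord xpredT (fun l => S l.+1 == S i.+1 : nat)).
  rewrite -(big_mkord xpredT (fun l => S l.+1 == S i.+1 : nat)).
  by rewrite [leqRHS](@big_cat_nat _ _ _ H.+1) //= leq_addr.
pose f i : nat := (S i.+1 \notin [seq S l.+1 | l <- iota 0 i]) && (t < visits (S i.+1) H'.+1)%N.
rewrite -(big_mkord xpredT f) -(big_mkord xpredT f).
by rewrite [leqRHS](@big_cat_nat _ _ _ n) //= leq_addr.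
Qed.

Lemma QE k n : (0 < k)%N ->
  Q X k n w = (\sum_(i < n) ((S i.+1 \notin [seq S l.+1 | l <- iota 0 i])
     && (visits (S i.+1) n == k)))%N.
Proof.
move=> k0; rewrite -(count_undup_first (fun i => S i.+1) (fun x => visits x n == k)).
rewrite /Q; apply: card_fset_set_count; first exact: undup_uniq.
move=> x; rewrite mem_undup /= local_timeE; split; last by move=> /andP[_ /eqP].
move=> vk; rewrite vk eqxx andbT; apply/mapP.
have : (0 < visits x n)%N by rewrite vk.
rewrite lt0n sum_nat_eq0 negb_forall => /existsP[l].
by rewrite eqb0 negbK => /eqP <-; exists (val l) => //; rewrite mem_iota ltn_ord.
Qed.

(** [word 1 n w] leaves out the first step, so its [n] letters describe the path from time 1 to time
    [n + 1]. *)
Lemma tailQE t n :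
  tailQ R X t.+1 n.+1 w = (visited_count (@lstep d) t n.+1 (word 1 n w))%:R.
Proof.
rewrite /tailQ; rewrite (limn_sum_count _
  (a := fun i : 'I_n.+1 => S i.+1 \notin [seq S l.+1 | l <- iota 0 i])
  (v := fun i : 'I_n.+1 => visits (S i.+1) n.+1)).
  by rewrite visited_countE.
by move=> j tj; rewrite QE //; apply: leq_trans tj.
Qed.

Lemma Q_diff t n : (Q X t.+1 n.+1 w + visited_count (@lstep d) t.+1 n.+1 (word 1 n w))%N
  = visited_count (@lstep d) t n.+1 (word 1 n w).
Proof.
rewrite QE // !visited_countE // -big_split; apply: eq_bigr => i _ /=.
case: (_ \notin _) => //=; rewrite [(t < _)%N]leq_eqVlt eq_sym.
by case: ltngtP.
Qed.

Hypothesis fin : forall o, exists M, forall L, (ret (word o L w) <= M)%N.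

(** The number of returns is bounded, so its maximum is attained at some horizon [L0]; a later visit
    would exceed it. *)
Lemma last_visit j : exists H0, forall l, (H0 <= l)%N -> S l.+1 <> S j.
Proof.
have [M MP] := fin j.
pose p m := `[< exists L, ret (word j L w) = m >].
have ex : exists m, p m by exists (ret (word j 0 w)); apply/asboolP; exists 0%N.
have ub m : p m -> (m <= M)%N by move=> /asboolP[L <-].
have [m /asboolP[L0 L0m] mmax] := ex_maxnP ex ub.
exists (j + L0)%N => l jl E; have := mmax (ret (word j (l - j).+1 w)).
have /[swap] /[apply] : p (ret (word j (l - j).+1 w)) by apply/asboolP; exists (l - j).+1.
rewrite -L0m !ret_word big_ord_recr /= subnKC; last by lia.
rewrite E eqxx addn1 ltnNge; apply/negP; rewrite negbK.
pose f l' : nat := S (j + l').+1 == S j.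
rewrite -(big_mkord xpredT f) -(big_mkord xpredT f).
by rewrite [leqRHS](@big_cat_nat _ _ _ L0) //= ?leq_addr //; lia.
Qed.

Lemma last_visits n : exists H0, forall j l, (j <= n)%N -> (H0 <= l)%N -> S l.+1 <> S j.
Proof.
elim: n => [|n [H0 IHn]].
  by have [H0 H] := last_visit 0; exists H0 => j l; rewrite leqn0 => /eqP ->; apply: H.
have [H1 H1P] := last_visit n.+1; exists (maxn H0 H1) => j l.
rewrite leq_eqVlt geq_max => /orP[/eqP ->|jn] /andP[h0 h1]; first exact: H1P.
exact: IHn.
Qed.

Lemma UE k n H : (forall j l, (j <= n)%N -> (H <= l)%N -> S l.+1 <> S j) ->
  U R X k n w = (\sum_(i < n) ((S i.+1 \notin [seq S l.+1 | l <- iota 0 i])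
     && (visits (S i.+1) H == k)))%N.
Proof.
move=> HP; pose p j := (S j.+1 \notin [seq S l.+1 | l <- iota 0 j]) && (visits (S j.+1) H == k).
have tot j : (j <= n)%N -> total_local_time R X (S j) w = (visits (S j) H)%:R%:E.
  move=> jn; rewrite -local_timeE /local_time /total_local_time.
  have -> : [set k0 | (1 <= k0)%N /\ S k0 = S j] = [set k0 | (0 < k0 <= H)%N /\ S k0 = S j].
    apply/seteqP; split=> l /=; last by move=> [/andP[l0 _]].
    move=> [l0 Sl]; split=> //; rewrite l0 /= leqNgt; apply/negP => Hl.
    apply: (HP j l.-1 jn); first by lia.
    by rewrite prednK.
  rewrite /counting; case: asboolP => // nf; case: nf.
  apply: (sub_finite_set (B := `I_H.+1)); last exact: finite_II.
  by move=> l /= [/andP[_ lH] _]; rewrite ltnS.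
rewrite /U (@card_fset_set_count _ (iota 1 n) (fun j => p j.-1)) ?iota_uniq //.
  by rewrite count_iota1.
move=> j; rewrite mem_iota add1n ltnS; split.
  move=> [/andP[j0 jn] tj nj]; rewrite j0 jn /= /p prednK //; apply/andP; split.
    apply/negP => /mapP[l]; rewrite mem_iota => /andP[_ lj]; apply: nj.
    by clear -j0 lj; lia.
  by move: tj; rewrite tot // => /eqP; rewrite eqe eqr_nat.
move=> /andP[/andP[j0 jn]]; rewrite /p prednK // => /andP[nj /eqP vk]; split.
- by rewrite j0 jn.
- by rewrite tot // vk.
- move=> l /andP[l0 lj] E; case/negP: nj; apply/mapP; exists l.-1; rewrite ?prednK //.
  by rewrite mem_iota; lia.
Qed.

(** A horizon past the last visits to the first [n] positions serves every [t] at once, so total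
    local times are read off a finite path. *)
Lemma tailU_spec n : exists H0, forall H, (H0 <= H)%N ->
  (forall t, tailU R X t.+1 n w = (visited_count (@lstep d) t n (word 1 H w))%:R) /\
  (forall t, (U R X t.+1 n w + visited_count (@lstep d) t.+1 n (word 1 H w))%N
    = visited_count (@lstep d) t n (word 1 H w)).
Proof.
have [H0 H0P] := last_visits n; exists (H0 + n)%N => H HH.
have nH : (n <= H.+1)%N by lia.
have HP : forall j l, (j <= n)%N -> (H.+1 <= l)%N -> S l.+1 <> S j.
  by move=> j l jn Hl; apply: H0P => //; lia.
split=> t.
  rewrite /tailU; rewrite (limn_sum_count _
    (a := fun i : 'I_n => S i.+1 \notin [seq S l.+1 | l <- iota 0 i])
    (v := fun i : 'I_n => visits (S i.+1) H.+1)).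
    by rewrite visited_countE.
  by move=> j tj; apply: UE.
rewrite (UE _ HP) // !visited_countE // -big_split; apply: eq_bigr => i _ /=.
case: (_ \notin _) => //=; rewrite [(t < _)%N]leq_eqVlt eq_sym.
by case: ltngtP.
Qed.

End Deterministic.

(** * The logarithmic threshold and convergence of the supremum *)

Section Asymptotics.
Variable R : realType.

(** Below the threshold [n (1 - g)^t >= (log n)^B], and the surplus [(log n)^(B - 2)] exceeds [C]
    once [log log n >= log C / (B - 2)]; hence the double exponential. *)
Lemma threshold_bound (g B C : R) : 0 < g < 1 -> 2 < B -> 0 < C ->
  exists n0, forall n t, (n0 <= n)%N -> t%:Z <= threshold g B n ->
    C * ln n%:R ^+ 2 <= n%:R * (1 - g) ^+ t.
Proof.
move=> /andP[g0 g1] B2 C0; have h0 : 0 < 1 - g by rewrite subr_gt0.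
have B20 : 0 < B - 2 by rewrite subr_gt0.
have l0 : ln (1 - g) < 0 by apply: ln_lt0; rewrite h0 gtrBl.
have [n0 n0P] := nat_ge_eventually (expR (expR (ln C / (B - 2))) + 1).
exists (n0 + 2)%N => n t nn; rewrite /threshold floor_ge_int.
have n1 : 1 < n%:R :> R by rewrite ltr1n; lia.
have n00 : 0 < n%:R :> R by apply: lt_trans n1.
have ln0 : 0 < ln n%:R :> R by rewrite ln_gt0.
have lnln : ln C / (B - 2) <= ln (ln n%:R).
  rewrite -[leLHS]expRK ler_ln ?posrE ?expR_gt0 // -[leLHS]expRK ler_ln ?posrE ?expR_gt0 //.
  have := n0P n; rewrite (leq_trans (leq_addr 2 n0) nn) => /(_ isT); lra.
move=> tT.
have tle : t%:R * - ln (1 - g) <= ln n%:R - B * ln (ln n%:R).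
  move: tT; rewrite /lambda pmulrn => tT.
  apply: le_trans (ler_wpM2r _ tT) _; first by rewrite oppr_ge0 ltW.
  rewrite le_eqVlt; apply/orP; left; apply/eqP; field.
  by rewrite lt_eqF.
have -> : C * ln n%:R ^+ 2 = expR (ln C + 2%:R * ln (ln n%:R)).
  by rewrite expRD expRM_natl !lnK ?posrE.
have -> : n%:R * (1 - g) ^+ t = expR (ln n%:R + t%:R * ln (1 - g)).
  by rewrite expRD expRM_natl !lnK ?posrE.
rewrite ler_expR; move: lnln; rewrite ler_pdivrMr //.
by move: (ln (ln n%:R)) (ln C) (ln (1 - g)) tle => a b c tle; lra.
Qed.

Lemma sup_dev_cvg (T : nat -> int) (f : nat -> nat -> R) :
  (forall e, 0 < e -> exists n0, forall n t, (n0 <= n)%N -> t.+1%:Z <= T n ->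
     `|f n t.+1 - 1| <= e) ->
  sup_dev (T n) (f n) @[n --> \oo] --> (0 : R).
Proof.
move=> H; apply/cvgrPdist_le => e e0; have [n0 n0P] := H e e0.
near=> n; have n0n : (n0 <= n)%N by near: n; exists n0.
rewrite sub0r normrN /sup_dev.
pose A : set R := [set `|f n t - 1| | t in [set t : nat | (0 < t)%N /\ t%:Z <= T n]].
rewrite -[sup _]/(sup A).
have Ae x : A x -> 0 <= x <= e.
  by move=> [[|t] [//= _ tT] <-]; rewrite normr_ge0; exact: n0P.
have [->|/set0P[x Ax]] := eqVneq A set0; first by rewrite sup0 normr0 ltW.
have ubA : ubound A e by move=> y /Ae /andP[].
rewrite ger0_norm; first by apply: ge_sup => //; exists x.
have /andP[x0 _] := Ae _ Ax.
by apply: le_trans x0 _; apply: ub_le_sup => //; exists e.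
Unshelve. all: by end_near. Qed.

End Asymptotics.

(** * From geometric scales to all n, and the four limits along one path *)

Section FixedPath.
Variables (R : realType) (disp : measure_display) (Omega : measurableType disp).
Variables (P : probability Omega R) (d : nat) (X : nat -> Omega -> 'rV[int]_d).
Variables (d0 : (0 < d)%N) (w : Omega).
Local Notation g := (escape_prob P X).
Local Notation h := (1 - g).
Hypothesis g0 : 0 < g.
Hypothesis g1 : g < 1.
Hypothesis Xw : forall k, X k w = lstep (dir X d0 k w).
Hypothesis fin : forall o, exists M, forall L, (ret (@lstep d) (word X d0 o L w) <= M)%N.
Hypothesis conc : forall p : nat, concentrated P X d0 (1 + p.+1%:R^-1) p.+1%:R^-1 w.

Local Notation VC t n H := (visited_count (@lstep d) t n (word X d0 1 H w)).

Let h0 : 0 < h. Proof. by rewrite subr_gt0. Qed.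
Let h1 : h < 1. Proof. by rewrite gtrBl. Qed.

Lemma scale_mono (rho : R) j k : 1 <= rho -> (j <= k)%N -> (scale rho j <= scale rho k)%N.
Proof. by move=> r1 jk; rewrite ltnS le_truncn // ler_weXn2l. Qed.

Lemma between_scales (rho : R) k1 n : 1 < rho -> (scale rho k1 <= n)%N ->
  exists2 k, (k1 <= k)%N & (scale rho k <= n < scale rho k.+1)%N.
Proof.
move=> r1 kn.
have ex : exists k, (n < scale rho k)%N.
  have [C C0 CP] := linear_le_exp r1.
  have [k kP] := nat_ge_eventually (C * n%:R); exists k.
  rewrite -(ltr_nat R); apply: le_lt_trans (scale_gt rho k).
  by rewrite -(ler_pM2l C0); apply: le_trans (kP k (leqnn _)) (CP k).
have [k nk kmin] := ex_minnP ex.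
case: k nk kmin => [|k] nk kmin.
  by have := leq_trans nk (leq_trans (scale_mono (ltW r1) (leq0n k1)) kn); rewrite ltnn.
exists k.
  rewrite leqNgt; apply/negP => kk1.
  by have := leq_trans nk (leq_trans (scale_mono (ltW r1) kk1) kn); rewrite ltnn.
by rewrite nk andbT leqNgt; apply/negP => /kmin; rewrite ltnn.
Qed.

Lemma core_bounds (e : R) : 0 < e -> exists (C : R) n0, 0 < C /\
  forall n t, (n0 <= n)%N -> C * ln n%:R ^+ 2 <= n%:R * h ^+ t ->
   (1 - e) * (n%:R * g * h ^+ t) <= (VC t n n.-1)%:R /\
   exists H1, forall H, (H1 <= H)%N -> (VC t n H)%:R <= (1 + e) * (n%:R * g * h ^+ t).
Proof.
move=> e0; have [p pP] := nat_ge_eventually (5 / e).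
have {}pP := pP p.+1 (leqnSn p).
(* Mesh and precision are both [x]: passing from [n] to a neighbouring scale costs a factor
   [1 + 2x], and [(1 + x)(1 + 2x) <= 1 + 5x]. *)
pose x : R := p.+1%:R^-1; have x0 : 0 < x by rewrite invr_gt0.
have x1 : x <= 1 by rewrite invf_le1 ?ltr0n // ler1n.
have xe : 5 * x <= e.
  by move: pP; rewrite ler_pdivrMr // mulrC => pP; rewrite ler_pdivrMr ?ltr0n.
pose rho := 1 + x; have r1 : 1 < rho by rewrite ltrDl.
have [k1 k1P] := conc p; rewrite -/x -/rho in k1P.
have [C1 C10 C1P] := linear_le_exp r1.
have [k2 k2P] := nat_ge_eventually (C1 / x).
have lr : 0 < ln rho by rewrite ln_gt0.
(* The 12 is [3 * 4]: [n] is at most three times the lower scale, and [(k + 1)^2 <= 4 k^2]; the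
   logarithm enters through [k log rho <= log n]. *)
pose C := 12 / ln rho ^+ 2.
pose N k := scale rho k.
exists C, (N (k1 + k2 + 1)%N); split; first by rewrite divr_gt0 // exprn_gt0.
move=> n t nn Cn; have [k kk /andP[Nn nN]] := between_scales r1 nn.
have rk0 : 0 < rho ^+ k by rewrite exprn_gt0 // (lt_trans _ r1).
have Nk : rho ^+ k < (N k)%:R := scale_gt rho k.
have Nk1 : (N k.+1)%:R <= rho ^+ k.+1 + 1 by apply: scale_le; rewrite ltW // (lt_trans _ r1).
have [k0 kk1 kk2] : [/\ (0 < k)%N, (k1 <= k)%N & (k2 <= k)%N] by clear -kk; split; lia.
(* The share [x rho^k] absorbs the rounding in [scale]. *)
have kx : 1 <= x * rho ^+ k.
  have : C1 / x <= k%:R by apply: k2P.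
  move=> /le_trans/(_ (C1P k)); rewrite -ler_pdivrMl // mulrA mulVf ?gt_eqF // mul1r.
  by rewrite -[X in X <= _]mul1r ler_pdivrMr // mulrC.
have ratio : (N k.+1)%:R <= (1 + 2 * x) * (N k)%:R.
  apply: le_trans Nk1 _; apply: (@le_trans _ _ ((1 + 2 * x) * rho ^+ k)).
    by rewrite exprS {1}/rho; move: (rho ^+ k) kx => y kx; lra.
  by rewrite ler_wpM2l ?(ltW Nk) //; lra.
have ht0 : 0 < h ^+ t by rewrite exprn_gt0.
have nR : (N k)%:R <= n%:R :> R by rewrite ler_nat.
have nR' : n%:R <= (N k.+1)%:R :> R by rewrite ler_nat ltnW.
have N0 : 0 < (N k)%:R :> R by rewrite ltr0n.
have n0 : 0 < n%:R :> R by apply: lt_le_trans nR.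
(* Strong enough for admissibility at both scales around [n]: the lower one gives the lower bound,
   the upper one the upper bound. *)
have big : k.+1%:R ^+ 2 <= (N k)%:R * h ^+ t.
  have lnn : k%:R * ln rho <= ln n%:R.
    rewrite mulr_natl -lnXn ?(lt_trans _ r1) // ler_ln ?posrE //.
    exact: le_trans (ltW Nk) nR.
  have kl0 : 0 <= k%:R * ln rho by rewrite mulr_ge0 // ltW.
  have lnn2 : (k%:R * ln rho) ^+ 2 <= ln n%:R ^+ 2.
    by rewrite lerXn2r ?nnegrE // (le_trans kl0).
  have A1 : 12 * k%:R ^+ 2 <= n%:R * h ^+ t.
    apply: le_trans Cn; rewrite /C -mulrA ler_wpM2l // mulrC ler_pdivlMr ?exprn_gt0 //.
    by rewrite -exprMn.
  have A2 : n%:R * h ^+ t <= 3 * ((N k)%:R * h ^+ t).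
    rewrite mulrA ler_pM2r //; apply: le_trans nR' (le_trans ratio _).
    by rewrite ler_wpM2r ?(ltW N0) //; lra.
  have A3 : k.+1%:R ^+ 2 <= 4 * k%:R ^+ 2 :> R.
    by rewrite -!natrX -natrM ler_nat; clear -k0; nia.
  by move: A1 A2 A3; lra.
have bigk : k%:R ^+ 2 <= (N k)%:R * h ^+ t.
  by apply: le_trans big; rewrite lerXn2r ?nnegrE ?ler_nat.
have bigk1 : k.+1%:R ^+ 2 <= (N k.+1)%:R * h ^+ t.
  by apply: le_trans big _; rewrite ler_pM2r // ler_nat scale_mono // ltW.
have gE : 1 - h = g by rewrite opprB addrC subrK.
have [low _] := k1P k kk1 t bigk.
have [_ up] := k1P k.+1 (leqW kk1) t bigk1.
rewrite !gE -!/(N _) in low up.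
have gh : 0 < g * h ^+ t by rewrite mulr_gt0.
split.
  apply: (@le_trans _ _ ((1 - x) * ((N k)%:R * g * h ^+ t))).
    rewrite -!mulrA.
    have [e1|e1] := leP 1 e.
      apply: (@le_trans _ _ 0); first by rewrite mulr_le0_ge0 ?subr_le0 // mulr_ge0 ?ltW.
      by rewrite mulr_ge0 ?subr_ge0 // mulr_ge0 ?ltW.
    rewrite [leLHS]mulrA [leRHS]mulrA ler_pM2r //.
    apply: (@le_trans _ _ ((1 - e) * ((1 + 2 * x) * (N k)%:R))).
      by rewrite ler_wpM2l ?subr_ge0 ?(ltW e1) // (le_trans nR' ratio).
    rewrite mulrA ler_pM2r //; move: xe x0 x1 e1; nra.
  apply: le_trans low _; rewrite ler_nat.
  have n00 : (0 < n)%N by apply: leq_trans Nn.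
  apply: visited_count_mono; [exact: Xw|exact: leqnn|exact: Nn| |by rewrite prednK].
  by rewrite -!subn1 leq_sub2r.
exists (N k.+1) => H HN.
apply: (@le_trans _ _ (VC t (N k.+1) H)%:R).
  rewrite ler_nat; apply: visited_count_mono => //.
  - exact: leq_trans (ltnW nN) (leqW HN).
  - exact: ltnW.
  - exact: leqW.
apply: le_trans (up H HN) _.
apply: (@le_trans _ _ ((1 + x) * ((1 + 2 * x) * n%:R * g * h ^+ t))).
  rewrite ler_wpM2l //; first by lra.
  rewrite ler_pM2r // ler_pM2r //; apply: le_trans ratio _.
  by rewrite ler_wpM2l //; lra.
rewrite (_ : (1 + x) * _ = (1 + x) * (1 + 2 * x) * (n%:R * g * h ^+ t)); last by ring.
apply: ler_wpM2r; first by rewrite !mulr_ge0 // ltW.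
move: xe x0 x1; nra.
Qed.

Lemma mu_succ t : mu g t.+1 = g * h ^+ t. Proof. by []. Qed.

Section Limits.
Variable B : R.
Hypothesis hB : 2 < B.
Local Notation tn := (threshold g B).

(** The range [s <= t + 1] covers both counts whose difference is U or Q at level [t + 1], namely
    those with [s = t] and [s = t + 1]. *)
Lemma threshold_bounds (e : R) : 0 < e -> exists n0, forall n t, (n0 <= n)%N ->
  t.+1%:Z <= tn n -> forall s, (s <= t.+1)%N ->
  let m := n%:R * mu g s.+1 in
  [/\ 0 < m, (1 - e) * m <= (VC s n n.-1)%:R, (VC s n n.-1)%:R <= (1 + e) * m &
   exists H1, forall H, (H1 <= H)%N -> (1 - e) * m <= (VC s n H)%:R <= (1 + e) * m].
Proof.
move=> e0; have [C [n1 [C0 HC]]] := core_bounds e0.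
have [n2 n2P] : exists n0, forall n t, (n0 <= n)%N -> t%:Z <= tn n ->
    C * ln n%:R ^+ 2 <= n%:R * h ^+ t.
  by apply: threshold_bound => //; rewrite g0.
exists (n1 + n2 + 1)%N => n t nn tT s st m.
have [n0 n1n n2n] : [/\ (0 < n)%N, (n1 <= n)%N & (n2 <= n)%N] by clear -nn; split; lia.
have n0R : 0 < n%:R :> R by rewrite ltr0n.
have mE : m = n%:R * g * h ^+ s by rewrite /m mu_succ mulrA.
have cond : C * ln n%:R ^+ 2 <= n%:R * h ^+ s.
  apply: le_trans (n2P n t.+1 n2n tT) _.
  by rewrite ler_pM2l // ler_wiXn2l // ltW.
have [low [H1 up]] := HC n s n1n cond.
rewrite -mE in low up.
have lowH H : (n <= H)%N -> (VC s n n.-1 <= VC s n H)%N.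
  by move=> nH; apply: visited_count_mono => //; rewrite ?prednK //;
    [apply: leq_trans (leq_pred n) nH|exact: leqW].
split=> //.
- by rewrite mE !mulr_gt0 ?exprn_gt0.
- apply: le_trans (up (H1 + n)%N (leq_addr _ _)).
  by rewrite ler_nat lowH // leq_addl.
exists (H1 + n)%N => H HH; rewrite up ?andbT; last by apply: leq_trans HH; rewrite leq_addr.
apply: le_trans low _; rewrite ler_nat lowH //.
by apply: leq_trans HH; rewrite leq_addl.
Qed.

Let ratio_close (e a m : R) : 0 < m -> (1 - e) * m <= a <= (1 + e) * m ->
  `|a / m - 1| <= e.
Proof.
move=> m0 /andP[am ma]; rewrite (_ : a / m - 1 = (a - m) / m); last by field; rewrite gt_eqF.
by rewrite normrM normfV (gtr0_norm m0) ler_pdivrMr // ler_norml; lra.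
Qed.

(** The means are [m] and [h m], with difference [g m]. The two errors add up to at most [2 e m],
    which is [2 e / g] relative to that difference. *)
Let diff_close (e a b c : R) n t : let m k := n%:R * mu g k in
  0 < m t.+1 -> (1 - e) * m t.+1 <= a <= (1 + e) * m t.+1 ->
  (1 - e) * m t.+2 <= b <= (1 + e) * m t.+2 -> 0 < e -> c + b = a ->
  `|c / (n%:R * g * mu g t.+1) - 1| <= 2 * e / g.
Proof.
move=> m m0 /andP[a1 a2] /andP[b1 b2] e0 cE.
have mS : m t.+2 = h * m t.+1 by rewrite /m !mu_succ exprS; ring.
have gE : n%:R * g * mu g t.+1 = g * m t.+1 by rewrite /m; ring.
have gm0 : 0 < g * m t.+1 by rewrite mulr_gt0.
rewrite gE (_ : _ - 1 = (c - g * m t.+1) / (g * m t.+1)); last first.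
  by field; rewrite !gt_eqF.
rewrite normrM normfV (gtr0_norm gm0) ler_pdivrMr //.
rewrite (_ : 2 * e / g * (g * m t.+1) = 2 * e * m t.+1); last by field; rewrite gt_eqF.
have ehm : e * (h * m t.+1) <= e * m t.+1.
  by rewrite ler_pM2l // ler_piMl ?(ltW m0) // ltW.
rewrite mS in b1 b2; rewrite ler_norml -cE in a1 a2 *.
have -> : g * m t.+1 = m t.+1 - h * m t.+1 by ring.
by move: (m t.+1) (h * m t.+1) a1 a2 b1 b2 ehm => M M'; lra.
Qed.

Lemma tailU_limit :
  sup_dev (tn n) (fun t => tailU R X t n w / (n%:R * mu g t)) @[n --> \oo] --> (0 : R).
Proof.
apply: sup_dev_cvg => e e0; have [n0 n0P] := threshold_bounds e0.
exists n0 => n t nn tT; have [m0 _ _ [H1 HH]] := n0P n t nn tT t (leqnSn t).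
have [H0 H0P] := tailU_spec R Xw fin n.
have [-> _] := H0P (H0 + H1)%N (leq_addr _ _).
by apply: ratio_close => //; apply: HH; rewrite leq_addl.
Qed.

Lemma tailQ_limit :
  sup_dev (tn n) (fun t => tailQ R X t n w / (n%:R * mu g t)) @[n --> \oo] --> (0 : R).
Proof.
apply: sup_dev_cvg => e e0; have [n0 n0P] := threshold_bounds e0.
exists n0.+1 => -[//|n] t nn tT.
have [m0 low up _] := n0P n.+1 t (ltnW nn) tT t (leqnSn t).
by rewrite (tailQE R Xw); apply: ratio_close => //; rewrite low.
Qed.

Lemma U_limit :
  sup_dev (tn n) (fun t => (U R X t n w)%:R / (n%:R * g * mu g t)) @[n --> \oo] --> (0 : R).
Proof.
apply: sup_dev_cvg => e e0; pose e' := e * g / 2.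
have e'0 : 0 < e' by rewrite /e' divr_gt0 // mulr_gt0.
have [n0 n0P] := threshold_bounds e'0.
exists n0 => n t nn tT; have [m0 _ _ [H1 HH]] := n0P n t nn tT t (leqnSn t).
have [_ _ _ [H2 HH2]] := n0P n t nn tT t.+1 (leqnn _).
have [H0 H0P] := tailU_spec R Xw fin n.
have [_ /(_ t) UV] := H0P (H0 + H1 + H2)%N (leq_trans (leq_addr _ _) (leq_addr _ _)).
have -> : e = 2 * e' / g by rewrite /e'; field; rewrite gt_eqF.
have L1 : (H1 <= H0 + H1 + H2)%N by rewrite -addnA addnCA leq_addr.
apply: (diff_close m0 (HH _ L1) (HH2 (H0 + H1 + H2)%N (leq_addl _ _)) e'0).
by rewrite -natrD UV.
Qed.

Lemma Q_limit :
  sup_dev (tn n) (fun t => (Q X t n w)%:R / (n%:R * g * mu g t)) @[n --> \oo] --> (0 : R).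
Proof.
apply: sup_dev_cvg => e e0; pose e' := e * g / 2.
have e'0 : 0 < e' by rewrite /e' divr_gt0 // mulr_gt0.
have [n0 n0P] := threshold_bounds e'0.
exists n0.+1 => -[//|n] t nn tT.
have [m0 low up _] := n0P n.+1 t (ltnW nn) tT t (leqnSn t).
have [_ low' up' _] := n0P n.+1 t (ltnW nn) tT t.+1 (leqnn _).
have -> : e = 2 * e' / g by rewrite /e'; field; rewrite gt_eqF.
have A : (1 - e') * (n.+1%:R * mu g t.+1) <= (VC t n.+1 n)%:R
    <= (1 + e') * (n.+1%:R * mu g t.+1) by apply/andP.
have A' : (1 - e') * (n.+1%:R * mu g t.+2) <= (VC t.+1 n.+1 n)%:R
    <= (1 + e') * (n.+1%:R * mu g t.+2) by apply/andP.
apply: (diff_close m0 A A' e'0).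
by rewrite -natrD (Q_diff Xw).
Qed.

End Limits.
End FixedPath.

Theorem mainTheorem1 (R : realType) (disp : measure_display)
    (Omega : measurableType disp) (P : probability Omega R) (d : nat)
    (X : nat -> Omega -> 'rV[int]_d) (B : R)
    (hd : (3 <= d)%N) (hX : simple_walk_steps P X) (hB : 2 < B) :
  let gamma := escape_prob P X in
  let tn := threshold gamma B in
  [/\ {ae P, forall w,
        sup_dev (tn n) (fun t => (U R X t n w)%:R / (n%:R * gamma * mu gamma t))
          @[n --> \oo] --> (0 : R)},
      {ae P, forall w,
        sup_dev (tn n) (fun t => (Q X t n w)%:R / (n%:R * gamma * mu gamma t))
          @[n --> \oo] --> (0 : R)},
      {ae P, forall w,
        sup_dev (tn n) (fun t => tailU R X t n w / (n%:R * mu gamma t))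
          @[n --> \oo] --> (0 : R)} &
      {ae P, forall w,
        sup_dev (tn n) (fun t => tailQ R X t n w / (n%:R * mu gamma t))
          @[n --> \oo] --> (0 : R)}].
Proof.
move=> gamma tn; have d0 : (0 < d)%N by exact: ltn_trans hd.
have g0 : 0 < gamma by have := h_lt1 hX hd d0; rewrite gtrBl.
have g1 : gamma < 1 by have := h_gt0 hX d0; rewrite subr_gt0.
have good : {ae P, forall w, [/\ forall k, X k w = lstep (dir X d0 k w),
    forall o, exists M, forall L, (ret (@lstep d) (word X d0 o L w) <= M)%N &
    forall p : nat, concentrated P X d0 (1 + p.+1%:R^-1) p.+1%:R^-1 w]}.
  (* Restricting to the precisions [1 / (p + 1)] leaves countably many null sets to unite. *)
  have conc : {ae P, forall w, forall p : nat,
      concentrated P X d0 (1 + p.+1%:R^-1) p.+1%:R^-1 w}.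
    apply: ae_foralln => p; apply: (ae_concentrated hX hd d0).
      by rewrite ltrDl invr_gt0 ltr0n.
    by rewrite invr_gt0 ltr0n /= invf_le1 ?ltr0n // ler1n.
  by have := ae_step hX d0; have := ae_finite_returns hX hd d0; move: conc;
    apply: filterS3 => w conc fin Xw; split.
split; move: good; apply: filterS => w [Xw fin conc].
- exact: (U_limit g0 g1 Xw fin conc hB).
- exact: (Q_limit g0 g1 Xw conc hB).
- exact: (tailU_limit g0 g1 Xw fin conc hB).
- exact: (tailQ_limit g0 g1 Xw conc hB).
Qed.
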